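(* Consider the Sturm–Liouville equation $-(py')'+qy=zwy$ on $(a,b)$, where $1/p,q,w\in L^1_{loc}(a,b)$, $w>0$, and $p,q$ are real-valued. Suppose that $a$ is in the limit circle case and $b$ is in the limit point case, and impose a Dirichlet boundary condition $y(a)=0$ at $a$. Let $c(z,\cdot),s(z,\cdot)$ be the solutions with the initial values given in the context, and let $m$ be the Weyl coefficient defined there. For $\xi\in\mathbb R$, let $\hat t_\xi:(0,\infty)\to(a,b)$ be a function satisfying $$\|c(\xi,\cdot)\|_{\hat t_\xi(r)}^2\,\|s(\xi,\cdot)\|_{\hat t_\xi(r)}^2-(c(\xi,\cdot),s(\xi,\cdot))_{\hat t_\xi(r)}^2\asymp\frac1{r^2},\qquad r\in(0,\infty).\qquad( * )$$ Then, for $r\in(0,\infty)$, $$\operatorname{Im}m(\xi+ir)\asymp\frac1{r\,\|s(\xi,\cdot)\|_{\hat t_\xi(r)}^2},\qquad \frac{\operatorname{Im}m(\xi+ir)}{|m(\xi+ir)|^2}\asymp\frac1{r\,\|c(\xi,\cdot)\|_{\hat t_\xi(r)}^2}.$$ The constants implicit in $\asymp$ are independent of $p,q,w$ and of $\xi$, but do depend on the constants pertaining to $\asymp$ in $( * )$.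
   Context: For $z\in\mathbb C$, $c(z,\cdot)$ and $s(z,\cdot)$ are the solutions of $-(py')'+qy=zwy$ on $(a,b)$ with initial values $$p(a)c'(z,a)=0,\quad c(z,a)=1,\qquad p(a)s'(z,a)=1,\quad s(z,a)=0,$$ where values at $a$ are understood as limits as $t\to a+$ of the solution and of its quasi-derivative $py'$; it is part of the setting that solutions with such initial values exist. The Weyl coefficient is, for $z\in\mathbb C\setminus\mathbb R$, the unique number $m(z)$ with $c(z,\cdot)+m(z)s(z,\cdot)\in L^2((a,b),w(x)\,dx)$. For $t\in(a,b)$, $(f,g)_t:=\int_a^tf(x)\overline{g(x)}w(x)\,dx$ and $\|f\|_t:=(f,f)_t^{1/2}$ denote the scalar product and norm of $L^2((a,t),w(x)\,dx)$. Notation: $f\asymp g$ means that there are constants $C_1,C_2>0$ with $C_1g\le f\le C_2g$ on the indicated range. *)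

(* Defs.v *)
From HB Require Import structures.
From mathcomp Require Import all_boot all_order all_algebra.
From mathcomp Require Import complex.
From mathcomp Require Import all_classical all_reals all_analysis.

Set Implicit Arguments.
Unset Strict Implicit.
Unset Printing Implicit Defensive.

Import Order.TTheory GRing.Theory Num.Theory.
Import numFieldNormedType.Exports.

Local Open Scope classical_set_scope.
Local Open Scope ring_scope.
Local Open Scope complex_scope.

Section SturmLiouville.
Context {R : realType}.
Implicit Types (D : set R) (a b : \bar R) (p q w : R -> R) (z : R[i]).

Local Notation mu := (@lebesgue_measure R).
Local Notation Re := (@complex.Re R).
Local Notation Im := (@complex.Im R).

Definition oitv a b : set R := [set x | (a < x%:E < b)%E].

(* f is locally absolutely continuous on D: an indefinite integral of a
   locally integrable function, on every compact interval inside D. *)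
Definition AC_loc D (f : R -> R) : Prop :=
  exists2 g : R -> R, locally_integrable D g &
    forall s t : R, s <= t -> `[s, t] `<=` D ->
      f t - f s = \int[mu]_(x in `[s, t]) g x.

Definition cAC_loc D (y : R -> R[i]) : Prop :=
  AC_loc D (Re \o y) /\ AC_loc D (Im \o y).

Definition cderive (y : R -> R[i]) (x : R) : R[i] :=
  derive1 (Re \o y) x +i* derive1 (Im \o y) x.

(* y solves -(p y')' + q y = z w y on (a, b).  The quasi-derivative p y' is
   only determined a.e. by y; y1 is its locally absolutely continuous
   representative. *)
Definition solution_qd p q w a b z (y y1 : R -> R[i]) : Prop :=
  [/\ cAC_loc (oitv a b) y, cAC_loc (oitv a b) y1,
      {ae mu, forall x, oitv a b x -> (p x)%:C * cderive y x = y1 x} &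
      {ae mu, forall x, oitv a b x ->
        - cderive y1 x + (q x)%:C * y x = z * (w x)%:C * y x}].

Definition solution p q w a b z (y : R -> R[i]) : Prop :=
  exists y1, solution_qd p q w a b z y y1.

(* The filter x -> a+; the value at +oo is irrelevant, since a < b below. *)
Definition at_left_end a : set_system R :=
  if a is r%:E then r^'+ else ninfty_nbhs R.

Definition ccvg (F : set_system R) (y : R -> R[i]) (l : R[i]) : Prop :=
  (Re \o y) @ F --> Re l /\ (Im \o y) @ F --> Im l.

Definition solution_ivp p q w a b z (y : R -> R[i]) (alpha beta : R[i]) : Prop :=
  exists2 y1, solution_qd p q w a b z y y1 &
    ccvg (at_left_end a) y alpha /\ ccvg (at_left_end a) y1 beta.

Definition in_L2 w D (f : R -> R[i]) : Prop :=
  [/\ measurable_fun D (Re \o f), measurable_fun D (Im \o f) &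
      mu.-integrable D (fun x => (Normc.normc (f x) ^+ 2 * w x)%:E)].

(* The choice of z is immaterial by Weyl's alternative. *)
Definition limit_circle_left p q w a b : Prop :=
  exists z, forall y, solution p q w a b z y ->
    exists2 t, oitv a b t & in_L2 w (oitv a t%:E) y.

Definition limit_circle_right p q w a b : Prop :=
  exists z, forall y, solution p q w a b z y ->
    exists2 t, oitv a b t & in_L2 w (oitv t%:E b) y.

Definition limit_point_right p q w a b : Prop := ~ limit_circle_right p q w a b.

Definition weyl_coefficient w a b (c s : R[i] -> R -> R[i]) (m : R[i] -> R[i])
    : Prop :=
  forall z, Im z != 0 ->
    [set u | in_L2 w (oitv a b) (fun x => c z x + u * s z x)] = [set m z].

Definition dotp w a (t : R) (f g : R -> R[i]) : R[i] :=
  let h x := f x * (g x)^* * (w x)%:C in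
  (\int[mu]_(x in oitv a t%:E) Re (h x))
    +i* (\int[mu]_(x in oitv a t%:E) Im (h x)).

Definition L2norm w a (t : R) (f : R -> R[i]) : R :=
  Num.sqrt (Re (dotp w a t f f)).

(* f is comparable to g on (0, oo), with constants C1 and C2.  For K = R[i]
   the order entails that the compared values are real. *)
Definition asymp (K : numFieldType) (C1 C2 : K) (f g : R -> K) : Prop :=
  forall r : R, 0 < r -> C1 * g r <= f r <= C2 * g r.

End SturmLiouville.

(* Main.v *)
Require Import Defs.
From mathcomp Require Import all_boot all_order all_algebra.
From mathcomp Require Import complex.
From mathcomp Require Import all_classical all_reals all_analysis.
From mathcomp Require Import measurable_realfun ring lra.
Import Order.TTheory GRing.Theory Num.Theory.
Import numFieldNormedType.Exports.
Local Open Scope classical_set_scope.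
Local Open Scope ring_scope.
Local Open Scope complex_scope.
Set Implicit Arguments.
Unset Strict Implicit.
Unset Printing Implicit Defensive.

(** Fix [xi] and [r > 0], put [z = xi + i r] and [t = that r], and let [C], [S]
    be the real functions [c(xi, .)], [s(xi, .)].  All norms are those of
    [L^2((a, t), w)]: [A = |C|^2], [D = |S|^2], [B = (C, S)], and the Gram
    determinant [Delta = A D - B^2] is comparable to [1 / r^2] by assumption.

    Let [f] solve the equation at [z] with [f(a) = f0] and [(p f')(a) = f1].
    Regarding [i r w f] as an inhomogeneity of the equation at [xi], variation
    of constants writes [f0 C + f1 S - f] as [i r] times a Volterra operator
    applied to [f], with kernel [C(x) S(y) - S(x) C(y)].  The integral of the
    square of this kernel over [(a, t) x (a, t)] is [2 Delta], hence
    [|f0 C + f1 S|^2 <= (2 + 4 r^2 Delta) |f|^2]  (lemma [energy_comparison]),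
    and the factor is at most [K = 2 + 4 C2].

    Take for [f] the Weyl solution [c(z, .) + m s(z, .)].  As [m] lies in the
    Weyl disc [{u | |c + u s|^2 <= Im u / r}], the comparison becomes
    [A + 2 B Re m + |m|^2 D <= K Im m / r].  The left-hand side is
    [|C + m S|^2], so it is at least [Delta / D] (the squared distance of [C] to
    the line through [S]), at least [|m|^2 Delta / A], at least [(Im m)^2 D] and
    at least [(Im m)^2 A / |m|^2].  These four minorants give the four
    inequalities of the theorem (lemma [weyl_bounds]).

    It remains to see that [m(z)] lies in all Weyl discs (lemma [weyl_point]).
    The discs are compact and decreasing in [t], and Green's identity produces
    a point in each of them, namely the [u] for which [c + u s] vanishes at
    [t].  For a common point [u] of the discs the function [c + u s] is
    square integrable up to [b], so that [u = m(z)] because [m(z)] is the only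
    number with this property.

    The identities of Green and Lagrange rest on integration by parts for
    absolutely continuous functions, a case of Fubini's theorem.  They extend
    to the singular endpoint [a]: in the limit circle case [c(z0, .)] is square
    integrable near [a] for some [z0], and as [c(z0, .)] tends to [1] there, [w]
    is integrable near [a].  Complex solutions are represented throughout by
    their real and imaginary parts. *)

(** * Absolutely continuous functions on a compact interval *)

Section Primitives.
Context {R : realType}.
Local Notation mu := (@lebesgue_measure R).
Implicit Types (f g : R -> R) (s t : R).

Definition primitive_on s t f (f' : R -> R) : Prop :=
  mu.-integrable `[s, t] (EFin \o f') /\
  forall x, s <= x <= t -> f x = f s + \int[mu]_(y in `[s, x]) f' y.

Lemma primitive_on_sub s t s' t' f f' : s <= s' -> s' <= t' -> t' <= t ->
  primitive_on s t f f' -> primitive_on s' t' f f'.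
Proof.
move=> ss' st' tt' [If Ef]; split.
  by apply: integrableS If => //; apply: subset_itv; rewrite bnd_simp.
move=> x /andP[s'x xt'].
have Ix : mu.-integrable `[s, x] (EFin \o f').
  by apply: integrableS If => //; apply: subset_itv;
    rewrite bnd_simp// (le_trans xt').
rewrite (Ef x) ?(le_trans ss')//= ?(le_trans xt')//
  (Ef s') ?ss' ?(le_trans st')//.
rewrite -addrA; congr (_ + _).
apply/eqP; rewrite addrC -subr_eq; apply/eqP.
rewrite Rintegral_itvB ?bnd_simp//.
by rewrite Rintegral_itv_obnd_cbnd//; apply: integrableS Ix => //;
  apply: subset_itvr; rewrite bnd_simp.
Qed.

Lemma primitive_on_within_continuous s t f f' : s <= t ->
  primitive_on s t f f' -> {within `[s, t], continuous f}.
Proof.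
move=> st [If Ef].
have := parameterized_integral_continuous st If => C.
have C' : {within `[s, t],
  continuous (cst (f s) + (fun x => parameterized_integral mu s x f'))}.
  by apply: within_continuousD => // x; exact: cst_continuous.
apply: subspace_eq_continuous C' => x /set_mem /=; rewrite in_itv/= => xst.
by rewrite /from_subspace /= (Ef x xst).
Qed.

Lemma EFin_Rintegral (D : set R) f : measurable D ->
  mu.-integrable D (EFin \o f) ->
  (\int[mu]_(x in D) f x)%:E = (\int[mu]_(x in D) (f x)%:E)%E.
Proof. by move=> mD If; rewrite fineK//; exact: integrable_fin_num. Qed.

Lemma integrable_bounded_mul (D : set R) (M : R) f g : measurable D ->
  measurable_fun D f -> (forall x, D x -> `|f x| <= M) ->
  mu.-integrable D (EFin \o g) ->
  mu.-integrable D (EFin \o (fun x => f x * g x)).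
Proof.
move=> mD mf fM Ig.
have mg : measurable_fun D g
  by apply/measurable_EFinP; exact: measurable_int Ig.
apply: (@le_integrable _ _ _ mu D mD _ (fun x => M%:E * (EFin \o g) x)%E);
  last first.
- exact: integrableZl.
- move=> x Dx /=; rewrite lee_fin !normrM ler_wpM2r//.
  by rewrite (le_trans (fM x Dx))// ler_norm.
- by apply/measurable_EFinP; exact: measurable_funM.
Qed.

Lemma primitive_on_bounded s t f f' : s <= t -> primitive_on s t f f' ->
  exists M, forall x, `[s, t]%classic x -> `|f x| <= M.
Proof.
move=> st /(primitive_on_within_continuous st) cf.
have [M1 _ h1] := EVT_max st cf.
have [M2 _ h2] := EVT_min st cf.
exists (Num.max `|f M1| `|f M2|) => x /= xst.
have := h1 _ xst; have := h2 _ xst.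
move=> lo hi; rewrite ler_norml le_max lerNl; apply/andP; split.
  by rewrite le_max; apply/orP; right;
    rewrite -normrN (le_trans _ (ler_norm _))// lerN2.
by rewrite (le_trans hi (ler_norm _)).
Qed.

Lemma primitive_on_measurable s t f f' : s <= t -> primitive_on s t f f' ->
  measurable_fun `[s, t] f.
Proof.
move=> st /(primitive_on_within_continuous st).
exact: subspace_continuous_measurable_fun.
Qed.

Lemma primitive_on_mul s t f f' g g' : s <= t ->
  primitive_on s t f f' -> primitive_on s t g g' ->
  mu.-integrable `[s, t] (EFin \o (fun x => f x * g' x)).
Proof.
move=> st Pf [Ig _].
have [M fM] := primitive_on_bounded st Pf.
by apply: integrable_bounded_mul fM Ig => //; exact: primitive_on_measurable Pf.
Qed.

(** Both iterated integrals of [f'(x) g'(y)] over the triangle [y <= x] can be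
    evaluated; Fubini's theorem equates them. *)
Lemma integration_by_parts_ac s t f f' g g' : s <= t ->
  primitive_on s t f f' -> primitive_on s t g g' ->
  f t * g t - f s * g s = \int[mu]_(x in `[s, t]) (f' x * g x + f x * g' x).
Proof.
move=> st Pf Pg; have [If Ef] := Pf; have [Ig Eg] := Pg.
pose F := f' \_ `[s, t]; pose G := g' \_ `[s, t].
have IF : mu.-integrable setT (EFin \o F).
  by rewrite -restrict_EFin; apply/integrable_restrict => //=; rewrite setTI.
have IG : mu.-integrable setT (EFin \o G).
  by rewrite -restrict_EFin; apply/integrable_restrict => //=; rewrite setTI.
have mF : measurable_fun setT F
  by apply/measurable_EFinP; exact: measurable_int IF.
have mG : measurable_fun setT G
  by apply/measurable_EFinP; exact: measurable_int IG.
pose h (z : R * R) : \bar R := (if z.2 <= z.1 then F z.1 * G z.2 else 0)%:E.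
have mh : measurable_fun setT h.
  apply/measurable_EFinP; apply: measurable_fun_ifT => //=.
  - by apply: measurable_fun_ler; [exact: measurable_snd|exact: measurable_fst].
  - by apply: measurable_funM; apply: measurableT_comp => //.
have Ih : (mu \x mu)%E.-integrable setT h.
  have mFG : measurable_fun setT (fun z : R * R => (F z.1 * G z.2)%:E).
    by apply/measurable_EFinP; apply: measurable_funM; apply: measurableT_comp.
  apply: (@le_integrable _ _ _ (mu \x mu)%E setT measurableT _
    (fun z : R * R => (F z.1 * G z.2)%:E)) => //.
    move=> z _; rewrite /h; case: ifP => // _.
    by rewrite abse0 abse_ge0.
  apply/integrable12ltyP => //=.
  under eq_integral => x _.
    under eq_integral => y _ do rewrite normrM EFinM.
    rewrite ge0_integralZl//; last first.
      by apply/measurable_EFinP; exact: measurableT_comp.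
    over.
  case/integrableP : IG => _ /= IG; case/integrableP : IF => _ /= IF.
  rewrite ge0_integralZr//.
  - by rewrite lte_mul_pinfty// ?integral_ge0// ge0_fin_numE// integral_ge0.
  - by apply/measurable_EFinP; exact: measurableT_comp.
  - exact: integral_ge0.
have inE' u v (z : R) : (z \in `[u, v]%classic) = (u <= z <= v).
  by apply/idP/idP => [/set_mem/=|zuv];
    [rewrite in_itv|apply/mem_set; rewrite /= in_itv].
have h1 x : (\int[mu]_y h (x, y) = (F x * (g x - g s))%:E)%E.
  rewrite /F patchE inE'; case: ifPn => [xst|xst]; last first.
    rewrite mul0r integral0_eq// => y _.
    by rewrite /h /F /= patchE inE' (negbTE xst) mul0r if_same.
  have /andP[sx xt] := xst.
  have Igx : mu.-integrable `[s, x] (EFin \o g').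
    by apply: integrableS Ig => //; apply: subset_itvl; rewrite bnd_simp.
  rewrite (Eg x xst) addrC addKr -RintegralZl//.
  rewrite EFin_Rintegral//; last exact: (integrableZl _ (f' x) Igx).
  rewrite [RHS]integral_mkcond; apply: eq_integral => y _.
  rewrite /h /F /G /= !patchE !inE' xst.
  case: (leP y x) => yx; rewrite ?andbF ?andbT//.
  by rewrite (le_trans yx xt) andbT; case: ifP => //; rewrite mulr0.
have h2 y : (\int[mu]_x h (x, y) = (G y * (f t - f y))%:E)%E.
  rewrite /G patchE inE'; case: ifPn => [yst|yst]; last first.
    rewrite mul0r integral0_eq// => x _.
    by rewrite /h /G /= patchE inE' (negbTE yst) mulr0 if_same.
  have /andP[sy yt] := yst.
  have Ify : mu.-integrable `[y, t] (EFin \o f').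
    by apply: integrableS If => //; apply: subset_itvr; rewrite bnd_simp.
  have [_ /(_ t)] := primitive_on_sub sy yt (lexx t) Pf.
  rewrite yt lexx => -> //; rewrite addrC addKr -RintegralZl//.
  rewrite EFin_Rintegral//; last exact: (integrableZl _ (g' y) Ify).
  rewrite [RHS]integral_mkcond; apply: eq_integral => x _.
  rewrite /h /F /G /= !patchE !inE' yst.
  case: (leP y x) => yx //=.
  by rewrite (le_trans sy yx)/=; case: ifP => //; rewrite ?mul0r// mulrC.
have := Fubini Ih; rewrite /=.
under eq_integral do rewrite h1.
under [X in _ = X -> _]eq_integral do rewrite h2.
move=> H.
have H' : \int[mu]_(x in `[s, t]) (f' x * (g x - g s)) =
          \int[mu]_(x in `[s, t]) (g' x * (f t - f x)).
  rewrite Rintegral_mkcond [RHS]Rintegral_mkcond /Rintegral; congr fine.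
  transitivity (\int[mu]_x (F x * (g x - g s))%:E)%E.
    by apply: eq_integral => x _; rewrite /F !patchE; case: ifP => //;
      rewrite mul0r.
  rewrite H.
  by apply: eq_integral => x _; rewrite /G !patchE; case: ifP => //;
    rewrite mul0r.
have I1 : mu.-integrable `[s, t] (EFin \o (fun x => g x * f' x))
  by exact: primitive_on_mul Pg Pf.
have I2 : mu.-integrable `[s, t] (EFin \o (fun x => f x * g' x))
  by exact: primitive_on_mul Pf Pg.
have I1' : mu.-integrable `[s, t] (EFin \o (fun x => f' x * g x)).
  by apply: eq_integrable I1 => // x _ /=; rewrite mulrC.
rewrite RintegralD//.
have E1 : \int[mu]_(x in `[s, t]) (f' x * (g x - g s)) =
    \int[mu]_(x in `[s, t]) (f' x * g x) - g s * (f t - f s).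
  have -> : f t - f s = \int[mu]_(x in `[s, t]) f' x.
    by rewrite (Ef t) ?st ?lexx// addrC addKr.
  rewrite -RintegralZl// -RintegralB//; last exact: (integrableZl _ (g s) If).
  by apply: eq_Rintegral => x _; ring.
have E2 : \int[mu]_(x in `[s, t]) (g' x * (f t - f x)) =
    f t * (g t - g s) - \int[mu]_(x in `[s, t]) (f x * g' x).
  have -> : g t - g s = \int[mu]_(x in `[s, t]) g' x.
    by rewrite (Eg t) ?st ?lexx// addrC addKr.
  rewrite -RintegralZl// -RintegralB//; last exact: (integrableZl _ (f t) Ig).
  by apply: eq_Rintegral => x _; ring.
by move: H'; rewrite E1 E2 => H'; lra.
Qed.

End Primitives.

(** Lets [filterS] and its variants combine statements that hold almost
    everywhere. *)
#[global] Instance lebesgue_ae_filter (R : realType) :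
  Filter (nbhs (almost_everywhere (@lebesgue_measure R))).
Proof. exact: ae_filter_ringOfSetsType. Qed.

Section Derivative.
Context {R : realType}.
Local Notation mu := (@lebesgue_measure R).

Lemma primitive_on_derive1 (s t : R) (f f' : R -> R) :
  primitive_on s t f f' ->
  {ae mu, forall x, s < x < t -> derive1 f x = f' x}.
Proof.
move=> [If Ef].
pose G := f' \_ `[s, t].
have IG : mu.-integrable setT (EFin \o G).
  by rewrite -restrict_EFin; apply/integrable_restrict => //=; rewrite setTI.
have lG : locally_integrable setT G
  by apply: open_integrable_locally => //; exact: openT.
have IGy y : mu.-integrable [set` Interval (BLeft s) (BRight y)] (EFin \o G).
  exact: integrableS IG.
have := FTC1 IGy lG.
apply: filterS => x H /andP[sx xt].
have [|dF EF] := H; first by [].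
set F := (fun x => Rintegral _ _ _) in dF EF.
have isF : is_derive x 1 F (G x).
  by split=> //; rewrite -derive1E.
have isF' : is_derive x 1 (cst (f s) + F) (G x).
  by rewrite -[G x]add0r; apply: is_deriveD.
have : is_derive x 1 f (G x).
  apply: near_eq_is_derive isF'.
  near=> y.
  have sy : s <= y by apply/ltW; near: y; exact: lt_nbhsr.
  have yt : y <= t by apply/ltW; near: y; exact: lt_nbhsl.
  rewrite (Ef y) ?sy//; congr (_ + _).
  apply: eq_Rintegral => z /set_mem /=; rewrite in_itv/= => /andP[sz zy].
  by rewrite /G patchE mem_set//= in_itv/= sz (le_trans zy).
case=> _; rewrite -derive1E => ->.
by rewrite /G patchE mem_set//= in_itv/= (ltW sx) ltW.
Unshelve. all: by end_near. Qed.

End Derivative.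

(** * Real solutions and the splitting of complex ones *)

Section RealSolutions.
Context {R : realType}.
Local Notation mu := (@lebesgue_measure R).
Variables (p q w : R -> R) (a b : \bar R).

(** The equation [- (p u')' + q u = w phi].  The right-hand side is an arbitrary
    function so that the real and the imaginary part of a complex solution, each
    of which involves the other, fall under one notion.  Densities on compact
    intervals replace derivatives, which makes the notion stable under linear
    combinations without any differentiability argument. *)
Definition real_solution (u u1 phi : R -> R) : Prop :=
  forall s t, oitv a b s -> oitv a b t -> s <= t ->
  exists u' u1', [/\ primitive_on s t u u', primitive_on s t u1 u1',
    {ae mu, forall x, s < x < t -> p x * u' x = u1 x} &
    {ae mu, forall x, s < x < t -> q x * u x - u1' x = w x * phi x}].

Lemma oitv_itv (s t : R) : oitv a b s -> oitv a b t -> `[s, t] `<=` oitv a b.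
Proof.
move=> /andP[as_ _] /andP[_ tb] x /=; rewrite in_itv/= => /andP[sx xt].
by rewrite /oitv /= (lt_le_trans as_) ?lee_fin//= (le_lt_trans _ tb)// lee_fin.
Qed.

Lemma locally_integrable_itv (s t : R) (f : R -> R) :
  oitv a b s -> oitv a b t -> locally_integrable (oitv a b) f ->
  mu.-integrable `[s, t] (EFin \o f).
Proof.
move=> Is It [mf oD lf]; have sub := oitv_itv Is It.
apply/integrableP; split.
  by apply/measurable_EFinP; apply: measurable_funS mf => //;
    exact: open_measurable.
by apply: lf => //; exact: segment_compact.
Qed.

Lemma AC_loc_primitive_on (f : R -> R) : AC_loc (oitv a b) f ->
  exists f', forall s t, oitv a b s -> oitv a b t -> primitive_on s t f f'.
Proof.
move=> [f' lf Ef]; exists f' => s t Is It; split;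
  first exact: locally_integrable_itv.
move=> x /andP[sx xt]; rewrite -Ef//; first by rewrite addrC subrK.
by apply: subset_trans (oitv_itv Is It); apply: subset_itvl; rewrite bnd_simp.
Qed.

Lemma solution_qd_real_solution z y y1 : solution_qd p q w a b z y y1 ->
  real_solution (@complex.Re R \o y) (@complex.Re R \o y1)
    (@complex.Re R \o (fun x => z * y x)) /\
  real_solution (@complex.Im R \o y) (@complex.Im R \o y1)
    (@complex.Im R \o (fun x => z * y x)).
Proof.
move=> [[/AC_loc_primitive_on[yr Pyr] /AC_loc_primitive_on[yi Pyi]]
  [/AC_loc_primitive_on[y1r Py1r] /AC_loc_primitive_on[y1i Py1i]] E1 E2].
split=> s t Is It st.
- exists yr, y1r; split; [exact: Pyr|exact: Py1r| |].
  + have := primitive_on_derive1 (Pyr _ _ Is It);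
      apply: filterS2 E1 => x E1 E xst.
    have := E1 (oitv_itv Is It (subset_itv_oo_cc xst)).
    by move=> /(congr1 (@complex.Re R)) /=; rewrite (E xst) mul0r subr0.
  + have := primitive_on_derive1 (Py1r _ _ Is It);
      apply: filterS2 E2 => x E2 E xst.
    have := E2 (oitv_itv Is It (subset_itv_oo_cc xst)).
    rewrite /=; case: (z) (y x) => [zr zi] [u v] /=.
    move=> /(congr1 (@complex.Re R)) /=; rewrite (E xst) => E0.
    have -> : q x * u - y1r x = - y1r x + (q x * u - 0 * v) by ring.
    by rewrite E0; ring.
- exists yi, y1i; split; [exact: Pyi|exact: Py1i| |].
  + have := primitive_on_derive1 (Pyi _ _ Is It);
      apply: filterS2 E1 => x E1 E xst.
    have := E1 (oitv_itv Is It (subset_itv_oo_cc xst)).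
    by move=> /(congr1 (@complex.Im R)) /=; rewrite (E xst) mul0r addr0.
  + have := primitive_on_derive1 (Py1i _ _ Is It);
      apply: filterS2 E2 => x E2 E xst.
    have := E2 (oitv_itv Is It (subset_itv_oo_cc xst)).
    rewrite /=; case: (z) (y x) => [zr zi] [u v] /=.
    move=> /(congr1 (@complex.Im R)) /=; rewrite (E xst) => E0.
    have -> : q x * v - y1i x = - y1i x + (q x * v + 0 * u) by ring.
    by rewrite E0; ring.
Qed.

End RealSolutions.

(** * Open intervals with extended real endpoints *)

Section OpenIntervals.
Context {R : realType}.
Implicit Types (a b : \bar R) (s t x : R).

Definition lbnd a : itv_bound R :=
  match a with r%:E => BRight r | -oo%E => -oo%O | +oo%E => +oo%O end.
Definition rbnd b : itv_bound R :=
  match b with r%:E => BLeft r | -oo%E => -oo%O | +oo%E => +oo%O end.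

Lemma oitvE a b : oitv a b = [set` Interval (lbnd a) (rbnd b)].
Proof.
rewrite /oitv; apply/seteqP; split=> x /=; rewrite in_itv/=;
  case: a b => [r| |] [r'| |] //=;
    rewrite ?lte_fin ?ltNyr ?ltry ?andbT ?andbF//.
Qed.

Lemma oitv_open a b : open (oitv a b).
Proof. by rewrite oitvE; apply: interval_open; [case: a|case: b]. Qed.

Lemma measurable_oitv a b : measurable (oitv a b).
Proof. by rewrite oitvE; exact: measurable_itv. Qed.

Lemma sub_oitv a b t : oitv a b t -> oitv a t%:E `<=` oitv a b.
Proof.
by move=> /andP[_ tb] x /andP[ax xt]; rewrite /oitv/= ax (lt_trans xt tb).
Qed.

Lemma near_left_end a t (P : R -> Prop) : (a < t%:E)%E ->
  (\forall x \near at_left_end a, P x) ->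
  exists2 x0, oitv a t%:E x0 & forall x, (a < x%:E)%E -> x <= x0 -> P x.
Proof.
case: a => [r| |] //=.
- rewrite lte_fin => rt [e /= e0 He].
  have ert : 0 < Num.min (e / 2) ((t - r) / 2).
    by rewrite lt_min !divr_gt0 ?subr_gt0.
  have ee : Num.min (e / 2) ((t - r) / 2) <= e / 2 by rewrite ge_min lexx.
  have et : Num.min (e / 2) ((t - r) / 2) <= (t - r) / 2
    by rewrite ge_min lexx orbT.
  move: (Num.min _ _) ert ee et => d d0 de dt.
  exists (r + d); first by rewrite /oitv/= !lte_fin; apply/andP; split; lra.
  move=> x; rewrite lte_fin => rx xrd; apply: He => //=.
  by rewrite ltr0_norm; lra.
- move=> _ [M [_ HM]]; exists (Num.min (M - 1) (t - 1)).
    by rewrite /oitv/= ltNyr lte_fin gt_min; apply/orP; right; lra.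
  move=> x _; rewrite le_min => /andP[xM _]; apply: HM; lra.
Qed.

#[global] Instance at_left_end_proper a : ProperFilter (at_left_end a).
Proof. by case: a => [r| |] /=; exact: _. Qed.

Lemma left_end_seq a t : (a < t%:E)%E ->
  exists2 s : nat -> R, (forall n, oitv a t%:E (s n)) &
    forall x, (a < x%:E)%E -> \forall n \near \oo, s n < x.
Proof.
case: a => [r| |] //=.
- rewrite lte_fin => rt; exists (fun n => r + (t - r) / n.+2%:R).
    move=> n; rewrite /oitv/= !lte_fin; apply/andP; split.
      by rewrite ltrDl divr_gt0 ?subr_gt0.
    rewrite -ltrBrDl ltr_pdivrMr// ltr_pMr ?subr_gt0// ltr1n//.
  move=> x; rewrite lte_fin => rx.
  have : 0 < (x - r) / (t - r) by rewrite divr_gt0 ?subr_gt0.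
  move=> h0; have := near_infty_natSinv_lt (PosNum h0).
  apply: filterS => n /=.
  move=> h; rewrite -ltrBrDl.
  move: h; rewrite ltr_pdivlMr ?subr_gt0// => h.
  apply: le_lt_trans h; rewrite mulrC ler_pM2r ?subr_gt0//.
  by rewrite lef_pV2 ?posrE// ler_nat.
- move=> _; exists (fun n => t - n.+1%:R).
    by move=> n; rewrite /oitv/= ltNyr lte_fin gtrBl ltr0Sn.
  move=> x _; near=> n; rewrite ltrBlDl -ltrBlDr.
  have : t - x < n%:R by near: n; exact: nbhs_infty_gtr.
  by move=> h; apply: lt_le_trans h _; rewrite ler_nat.
Unshelve. all: by end_near. Qed.

Lemma right_end_seq b t : (t%:E < b)%E ->
  exists T : nat -> R, [/\ nondecreasing_seq T, forall n, t <= T n,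
    forall n, ((T n)%:E < b)%E &
    forall x, (x%:E < b)%E -> \forall n \near \oo, x < T n].
Proof.
case: b => [r| |] //=.
- rewrite lte_fin => tr; exists (fun n => r - (r - t) / n.+1%:R); split.
  + move=> m n mn; rewrite lerD2l lerN2 ler_pM2l ?subr_gt0//.
    by rewrite lef_pV2 ?posrE// ler_nat.
  + move=> n; rewrite lerBrDr -lerBrDl ler_pdivrMr//.
    by rewrite ler_peMr ?subr_ge0 ?(ltW tr)// ler1n.
  + by move=> n; rewrite lte_fin ltrBlDr ltrDl divr_gt0// subr_gt0.
  + move=> x; rewrite lte_fin => rx.
    have : 0 < (r - x) / (r - t) by rewrite divr_gt0 ?subr_gt0.
    move=> h0; have := near_infty_natSinv_lt (PosNum h0).
    apply: filterS => n /=.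
    rewrite ltr_pdivlMr ?subr_gt0// => h.
    by rewrite ltrBrDr -ltrBrDl mulrC.
- move=> _; exists (fun n => t + n%:R); split.
  + by move=> m n mn; rewrite lerD2l ler_nat.
  + by move=> n; rewrite lerDl.
  + by move=> n; rewrite ltry.
  + move=> x _; near=> n; rewrite -ltrBlDl.
    by near: n; exact: nbhs_infty_gtr.
Unshelve. all: by end_near. Qed.

End OpenIntervals.

(** * Integrals against the weight *)

Section Tame.
Context {R : realType}.
Local Notation mu := (@lebesgue_measure R).
Variables (a b : \bar R).
Implicit Types (f g : R -> R).

(** Functions on [(a, b)] that are continuous up to the left endpoint, where
    they have a finite limit.  They are bounded on [(a, t)], hence integrable
    against [w] there, and they form an algebra, so the integrability of every
    integrand below follows from its shape. *)
Definition tame f : Prop :=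
  (forall x, oitv a b x -> {for x, continuous f}) /\
  exists l : R, f x @[x --> at_left_end a] --> l.

Lemma tame_cst k : tame (cst k).
Proof. by split=> [x _|]; [exact: cst_continuous|exists k; exact: cvg_cst]. Qed.

Lemma tameD f g : tame f -> tame g -> tame (fun x => f x + g x).
Proof.
move=> [cf [l fl]] [cg [k gk]]; split=> [x Ix|].
  by apply: cvgD; [exact: cf|exact: cg].
by exists (l + k); exact: cvgD.
Qed.

Lemma tameM f g : tame f -> tame g -> tame (fun x => f x * g x).
Proof.
move=> [cf [l fl]] [cg [k gk]]; split=> [x Ix|].
  by apply: cvgM; [exact: cf|exact: cg].
by exists (l * k); exact: cvgM.
Qed.

Lemma tameZ k f : tame f -> tame (fun x => k * f x).
Proof. exact/tameM/tame_cst. Qed.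

Lemma tameN f : tame f -> tame (fun x => - f x).
Proof.
by move=> /(tameZ (-1)); under [X in tame X]eq_fun do rewrite mulN1r.
Qed.

Lemma tameB f g : tame f -> tame g -> tame (fun x => f x - g x).
Proof. by move=> tf tg; apply: tameD => //; exact: tameN. Qed.

Lemma tameX n f : tame f -> tame (fun x => f x ^+ n).
Proof.
move=> tf; elim: n => [|n IH]; first exact: tame_cst.
by under [X in tame X]eq_fun do rewrite exprS; exact: tameM.
Qed.

Lemma tame_measurable f : tame f -> measurable_fun (oitv a b) f.
Proof.
move=> [cf _]; apply: open_continuous_measurable_fun; first exact: oitv_open.
by move=> x /set_mem; exact: cf.
Qed.

Lemma tame_bounded f t : oitv a b t -> tame f ->
  exists M, forall x, (a < x%:E)%E -> x <= t -> `|f x| <= M.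
Proof.
move=> It [cf [l fl]]; have /andP[at_ tb] := It.
have : \forall x \near at_left_end a, `|f x| < `|l| + 1.
  by apply: (cvgr_lt `|l|); [exact: cvg_norm|rewrite ltrDl].
move=> /(near_left_end at_)[x0 /andP[ax0 x0t] h0].
have x0t' : x0 <= t by rewrite ltW.
have Ix0 : oitv a b x0 by rewrite /oitv/= ax0 (lt_trans x0t tb).
have cfw : {within `[x0, t], continuous (fun x => `|f x|)}.
  apply: continuous_in_subspaceT => x /set_mem/(oitv_itv Ix0 It) Ix.
  by apply: cvg_norm; exact: cf.
have [m _ hm] := EVT_max x0t' cfw.
exists (Num.max (`|l| + 1) `|f m|) => x ax xt; rewrite le_max.
have [xx0|x0x] := leP x x0; first by rewrite (ltW (h0 _ ax xx0)).
by rewrite hm ?orbT// in_itv/= (ltW x0x).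
Qed.

Variable w : R -> R.
Hypothesis w_int : forall t, oitv a b t ->
  mu.-integrable (oitv a t%:E) (EFin \o w).

Lemma tame_integrable f t : oitv a b t -> tame f ->
  mu.-integrable (oitv a t%:E) (EFin \o (fun x => f x * w x)).
Proof.
move=> It tf; have [M HM] := tame_bounded It tf.
have mI := measurable_oitv a t%:E.
apply: (@integrable_bounded_mul _ _ M) => //.
- apply: measurable_funS (tame_measurable tf); first exact: measurable_oitv.
  exact: sub_oitv.
- by move=> x /andP[ax xt]; apply: HM => //; apply: ltW; rewrite -lte_fin.
- exact: w_int.
Qed.

Definition wint (t : R) f : R := \int[mu]_(x in oitv a t%:E) (f x * w x).

Lemma wintD t f g : oitv a b t -> tame f -> tame g ->
  wint t (fun x => f x + g x) = wint t f + wint t g.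
Proof.
move=> It tf tg; rewrite /wint -RintegralD;
  [|exact: measurable_oitv|exact: tame_integrable..].
by apply: eq_Rintegral => x _; rewrite mulrDl.
Qed.

Lemma wintZ t k f : oitv a b t -> tame f ->
  wint t (fun x => k * f x) = k * wint t f.
Proof.
move=> It tf; rewrite /wint -RintegralZl;
  [|exact: measurable_oitv|exact: tame_integrable].
by apply: eq_Rintegral => x _; rewrite mulrA.
Qed.

Lemma eq_wint t f g : (forall x, oitv a t%:E x -> f x = g x) ->
  wint t f = wint t g.
Proof.
by move=> fg; apply: eq_Rintegral => x /set_mem /fg ->.
Qed.

Hypothesis w_pos : {ae mu, forall x, oitv a b x -> 0 < w x}.

(** As [w] is positive only almost everywhere, positivity of the integral is
    obtained by replacing the integrand with its absolute value. *)
Lemma wint_abs t f : oitv a b t -> tame f ->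
  (forall x, oitv a t%:E x -> 0 <= f x) ->
  (\int[mu]_(x in oitv a t%:E) (f x * w x)%:E =
   \int[mu]_(x in oitv a t%:E) (`|f x * w x|)%:E)%E.
Proof.
move=> It tf f0; have If := tame_integrable It tf.
apply: ae_eq_integral => //.
- exact: measurable_oitv.
- exact: measurable_int If.
- apply/measurable_EFinP; apply: measurableT_comp => //.
  by apply/measurable_EFinP; exact: measurable_int If.
- apply: filterS w_pos => x w0 Ix.
  by rewrite ger0_norm// mulr_ge0 ?f0// ltW// w0//; exact: (sub_oitv It).
Qed.

Lemma wint_ge0 t f : oitv a b t -> tame f ->
  (forall x, oitv a t%:E x -> 0 <= f x) ->
  0 <= wint t f.
Proof.
move=> It tf f0; rewrite /wint/Rintegral wint_abs// fine_ge0// integral_ge0//.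
Qed.

Lemma wint_le t f g : oitv a b t -> tame f -> tame g ->
  (forall x, oitv a t%:E x -> f x <= g x) -> wint t f <= wint t g.
Proof.
move=> It tf tg fg; rewrite -subr_ge0 -[- wint t f]mulN1r -wintZ// -wintD//;
  last exact: tameZ.
apply: wint_ge0 => //; first by apply: tameD => //; exact: tameZ.
by move=> x Ix; rewrite mulN1r subr_ge0 fg.
Qed.

Lemma wint_mono s t f : oitv a b t -> oitv a t%:E s -> tame f ->
  (forall x, oitv a t%:E x -> 0 <= f x) -> wint s f <= wint t f.
Proof.
move=> It Is tf f0; have Is' := sub_oitv It Is.
have f0' x : oitv a s%:E x -> 0 <= f x by move=> /(sub_oitv Is); exact: f0.
rewrite /wint/Rintegral !wint_abs// fine_le//.
- by apply: integrable_fin_num;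
    [exact: measurable_oitv|exact: (integrable_norm (tame_integrable Is' tf))].
- by apply: integrable_fin_num;
    [exact: measurable_oitv|exact: (integrable_norm (tame_integrable It tf))].
- apply: ge0_subset_integral;
    [exact: measurable_oitv|exact: measurable_oitv| | |].
  + by have := integrable_norm (tame_integrable It tf) => /measurable_int.
  + by [].
  + exact: sub_oitv.
Qed.

End Tame.

(** * Lagrange's identity *)

Section Lagrange.
Context {R : realType}.
Local Notation mu := (@lebesgue_measure R).
Variables (p q w : R -> R) (a b : \bar R).

Lemma integrable_lin (D : set R) (k l : R) (f g : R -> R) : measurable D ->
  mu.-integrable D (EFin \o f) -> mu.-integrable D (EFin \o g) ->
  mu.-integrable D (EFin \o (fun x => k * f x + l * g x)).
Proof.
move=> mD If Ig.
have := @integrableD _ _ _ mu D mD _ _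
  (@integrableZl _ _ _ mu D mD k _ If) (@integrableZl _ _ _ mu D mD l _ Ig).
by apply: eq_integrable.
Qed.

Lemma primitive_on_lin (s t k l : R) (f f' g g' : R -> R) :
  primitive_on s t f f' -> primitive_on s t g g' ->
  primitive_on s t (fun x => k * f x + l * g x) (fun x => k * f' x + l * g' x).
Proof.
move=> [If Ef] [Ig Eg].
split.
  exact: integrable_lin.
move=> x xst; have /andP[sx xt] := xst.
have sub : `[s, x] `<=` `[s, t] by apply: subset_itvl; rewrite bnd_simp.
have Ifx : mu.-integrable `[s, x] (EFin \o f') by exact: integrableS If.
have Igx : mu.-integrable `[s, x] (EFin \o g') by exact: integrableS Ig.
rewrite RintegralD//;
  [|exact: (integrableZl _ k Ifx)|exact: (integrableZl _ l Igx)].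
by rewrite !RintegralZl// (Ef x xst) (Eg x xst); ring.
Qed.

Local Notation real_solution := (real_solution p q w a b).

Lemma real_solution_lin (k l : R) u u1 phi v v1 psi : real_solution u u1 phi ->
  real_solution v v1 psi ->
  real_solution (fun x => k * u x + l * v x) (fun x => k * u1 x + l * v1 x)
       (fun x => k * phi x + l * psi x).
Proof.
move=> su sv s t Is It st.
have [u' [u1' [Pu Pu1 Eu Eu1]]] := su _ _ Is It st.
have [v' [v1' [Pv Pv1 Ev Ev1]]] := sv _ _ Is It st.
exists (fun x => k * u' x + l * v' x), (fun x => k * u1' x + l * v1' x); split.
- exact: primitive_on_lin.
- exact: primitive_on_lin.
- apply: filterS2 Eu Ev => x E E' xst.
  by rewrite -(E xst) -(E' xst); ring.
- apply: filterS2 Eu1 Ev1 => x E E' xst.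
  by rewrite [RHS]mulrDr !(mulrCA (w x)) -(E xst) -(E' xst); ring.
Qed.

Lemma oitv_around x : oitv a b x ->
  exists s t, [/\ oitv a b s, oitv a b t, s < x & x < t].
Proof.
move=> /andP[ax xb].
have [s Hs _] := left_end_seq ax.
have [T [_ T1 T2 T3]] := right_end_seq xb.
have [n _ /(_ n (leqnn n)) xT] := T3 _ xb.
have /andP[as0 s0x] := Hs 0.
exists (s 0), (T n); split.
- by rewrite /oitv/= as0 (lt_trans s0x).
- by rewrite /oitv/= T2 andbT (lt_trans ax).
- by rewrite -lte_fin.
- by [].
Qed.

Lemma real_solution_continuous u u1 phi : real_solution u u1 phi ->
  (forall x, oitv a b x -> {for x, continuous u}) /\
  (forall x, oitv a b x -> {for x, continuous u1}).
Proof.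
move=> su; split=> x /oitv_around[s [t [Is It sx xt]]];
  have [u' [u1' [Pu Pu1 _ _]]] := su _ _ Is It (ltW (lt_trans sx xt)).
- have /(continuous_within_itvP _ (lt_trans sx xt))[+ _ _] :=
    primitive_on_within_continuous (ltW (lt_trans sx xt)) Pu.
  by apply; rewrite in_itv/= sx.
- have /(continuous_within_itvP _ (lt_trans sx xt))[+ _ _] :=
    primitive_on_within_continuous (ltW (lt_trans sx xt)) Pu1.
  by apply; rewrite in_itv/= sx.
Qed.

(** The initial values are limits at the left endpoint, which may be infinite
    or singular. *)
Definition real_ivp u u1 phi (u0 u10 : R) : Prop :=
  [/\ real_solution u u1 phi, u x @[x --> at_left_end a] --> u0 &
      u1 x @[x --> at_left_end a] --> u10].

Lemma real_ivp_tame u u1 phi u0 u10 : real_ivp u u1 phi u0 u10 ->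
  tame a b u /\ tame a b u1.
Proof.
by move=> [/real_solution_continuous[cu cu1] l l1]; split; split => //;
  eexists; eassumption.
Qed.

Lemma real_ivp_lin (k l : R) u u1 phi u0 u10 v v1 psi v0 v10 :
  real_ivp u u1 phi u0 u10 -> real_ivp v v1 psi v0 v10 ->
  real_ivp (fun x => k * u x + l * v x) (fun x => k * u1 x + l * v1 x)
       (fun x => k * phi x + l * psi x) (k * u0 + l * v0) (k * u10 + l * v10).
Proof.
move=> [su lu lu1] [sv lv lv1]; split; first exact: real_solution_lin.
- by apply: cvgD; apply: cvgM => //; exact: cvg_cst.
- by apply: cvgD; apply: cvgM => //; exact: cvg_cst.
Qed.

Hypothesis w_loc : locally_integrable (oitv a b) w.

Definition wronskian (u u1 v v1 : R -> R) x := u x * v1 x - u1 x * v x.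

(** In the derivative of [u v1 - u1 v] the terms [u' v1] and [u1 v'] are both
    [p u' v']; by the same symmetry the potential [q] drops out. *)
Lemma lagrange_compact u u1 phi v v1 psi s t :
  real_solution u u1 phi -> real_solution v v1 psi -> tame a b phi ->
    tame a b psi ->
  oitv a b s -> oitv a b t -> s <= t ->
  wronskian u u1 v v1 t - wronskian u u1 v v1 s =
  \int[mu]_(x in `[s, t]) ((phi x * v x - u x * psi x) * w x).
Proof.
move=> su sv tphi tpsi Is It st.
have [cu _] := real_solution_continuous su;
  have [cv _] := real_solution_continuous sv.
have [u' [u1' [Pu Pu1 Eu Eu1]]] := su _ _ Is It st.
have [v' [v1' [Pv Pv1 Ev Ev1]]] := sv _ _ Is It st.
have -> : wronskian u u1 v v1 t - wronskian u u1 v v1 s =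
  (u t * v1 t - u s * v1 s) - (u1 t * v t - u1 s * v s) by rewrite /wronskian;
    ring.
rewrite (integration_by_parts_ac st Pu Pv1) (integration_by_parts_ac st Pu1 Pv).
have mst : measurable `[s, t]%classic by [].
have I1 : mu.-integrable `[s, t] (EFin \o (fun x => u' x * v1 x + u x * v1' x)).
  have := integrable_lin 1 1 mst (primitive_on_mul st Pv1 Pu)
    (primitive_on_mul st Pu Pv1).
  by apply: eq_integrable => // x _ /=; rewrite !mul1r (mulrC (v1 x)).
have I2 : mu.-integrable `[s, t] (EFin \o (fun x => u1' x * v x + u1 x * v' x)).
  have := integrable_lin 1 1 mst (primitive_on_mul st Pv Pu1)
    (primitive_on_mul st Pu1 Pv).
  by apply: eq_integrable => // x _ /=; rewrite !mul1r (mulrC (v x)).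
rewrite -RintegralB//; congr fine.
have mI : measurable_fun `[s, t] (fun x => (phi x * v x - u x * psi x) * w x).
  have mO : measurable (oitv a b) by exact: measurable_oitv.
  have sub : `[s, t] `<=` oitv a b by exact: oitv_itv.
  apply: (measurable_funS mO sub); apply: measurable_funM; last by case: w_loc.
  have tu : measurable_fun (oitv a b) u.
    by apply: open_continuous_measurable_fun;
      [exact: oitv_open|move=> x /set_mem; exact: cu].
  have tv : measurable_fun (oitv a b) v.
    by apply: open_continuous_measurable_fun;
      [exact: oitv_open|move=> x /set_mem; exact: cv].
  by apply: measurable_funB; apply: measurable_funM => //;
    exact: tame_measurable.
apply: ae_eq_integral => //.
- have := integrable_lin 1 (-1) mst I1 I2 => /measurable_int.
  by apply: eq_measurable_fun => x _ /=; rewrite mul1r mulN1r.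
- exact/measurable_EFinP.
(* The densities satisfy the differential equations only almost everywhere on
   the open interval; the endpoints are a null set. *)
have ae1 : {ae mu, forall x, x != s /\ x != t}.
  exists [set s; t]; split.
  - by apply: measurableU; exact: measurable_set1.
  - by apply: countable_lebesgue_measure0; apply: finite_set_countable;
      exact: finite_set2.
  - by move=> x /= /not_andP[] /negP; rewrite negbK => /eqP ->; [left|right].
apply: filterS2 (filterI Eu Eu1) (filterI ae1 (filterI Ev Ev1)).
move=> x [{}Eu {}Eu1] [[xs xt] [{}Ev {}Ev1]].
rewrite /= in_itv/= => /andP[sx xt'].
have {sx xt'}sxt : s < x < t by rewrite !lt_def xs sx eq_sym xt.
move: (Eu sxt) (Eu1 sxt) (Ev sxt) (Ev1 sxt) => {}Eu {}Eu1 {}Ev {}Ev1.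
congr EFin.
have -> : u' x * v1 x + u x * v1' x - (u1' x * v x + u1 x * v' x) =
  (q x * u x - u1' x) * v x - u x * (q x * v x - v1' x) by rewrite -Ev -Eu;
    ring.
by rewrite Eu1 Ev1; ring.
Qed.

End Lagrange.

Section LagrangeEnd.
Context {R : realType}.
Local Notation mu := (@lebesgue_measure R).
Variables (p q w : R -> R) (a b : \bar R).
Hypothesis w_loc : locally_integrable (oitv a b) w.
Hypothesis w_int : forall t, oitv a b t ->
  mu.-integrable (oitv a t%:E) (EFin \o w).

Lemma wint_itv s t f : oitv a b t -> oitv a t%:E s -> tame a b f ->
  wint a w t f - wint a w s f = \int[mu]_(x in `[s, t]) (f x * w x).
Proof.
move=> It Is tf; have Is' := sub_oitv It Is; have /andP[as_ st] := Is.
have If := tame_integrable w_int It tf.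
have Ifs := tame_integrable w_int Is' tf.
move: If Ifs; rewrite /wint !oitvE /= => If Ifs.
rewrite (Rintegral_itv_bndo_bndc Ifs) Rintegral_itvB//; last first.
  by case: (a) as_ => [r| |] //= /ltW.
have sub1 : `[s, t[ `<=` [set` Interval (lbnd a) (BLeft t)].
  apply: subset_itvr.
  by case: (a) as_ => [r| |].
rewrite Rintegral_itv_obnd_cbnd; last first.
  apply: integrableS If => //; apply: subset_trans sub1; apply: subset_itvr.
  by rewrite bnd_simp.
by rewrite Rintegral_itv_bndo_bndc//; exact: integrableS If.
Qed.

(** Dominated convergence, the integrands vanishing eventually at each point. *)
Lemma wint_left_end s t f : oitv a b t -> (forall n, oitv a t%:E (s n)) ->
  (forall x, (a < x%:E)%E -> \forall n \near \oo, s n < x) -> tame a b f ->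
  wint a w (s n) f @[n --> \oo] --> 0.
Proof.
move=> It Is s_lim tf.
have If := tame_integrable w_int It tf.
set D := oitv a t%:E in If.
pose h n : R -> \bar R := (fun x => (f x * w x)%:E) \_ (oitv a (s n)%:E).
have mD : measurable D by exact: measurable_oitv.
have mf := measurable_int _ If.
have [] := @dominated_convergence _ _ _ mu D mD h (cst 0%E)
  (fun x => (`|f x * w x|)%:E).
- move=> n; apply/(measurable_restrict _ _ _).1 => //;
    first exact: measurable_oitv.
  by apply: measurable_funS mf => //; exact: subIsetl.
- exact: measurable_cst.
- apply: aeW => x /andP[ax xt].
  apply: cvg_near_cst; have := s_lim _ ax; apply: filterS => n snx.
  rewrite /h patchE memNset//= => /andP[_]; rewrite lte_fin ltNge.
  by rewrite (ltW snx).
- exact: integrable_norm If.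
- apply: aeW => x n _; rewrite /h patchE; case: ifP => // _.
  by rewrite abse0 lee_fin.
move=> _ _; rewrite integral0 => h0.
have E n : wint a w (s n) f = fine (\int[mu]_(x in D) h n x)%E.
  rewrite /wint /Rintegral /h -integral_mkcondr setIidr//.
  exact: sub_oitv.
under eq_fun do rewrite E.
by apply: fine_cvg h0.
Qed.

(** Lagrange's identity on [(a, t)], obtained from the compact case on [[s, t]]
    by letting [s] tend to the left endpoint. *)
Lemma lagrange_identity u u1 phi u0 u10 v v1 psi v0 v10 t :
  real_ivp p q w a b u u1 phi u0 u10 -> real_ivp p q w a b v v1 psi v0 v10 ->
  tame a b phi -> tame a b psi -> oitv a b t ->
  wronskian u u1 v v1 t =
  u0 * v10 - u10 * v0 + wint a w t (fun x => phi x * v x - u x * psi x).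
Proof.
move=> Su Sv tphi tpsi It.
have [tu tu1] := real_ivp_tame Su; have [tv tv1] := real_ivp_tame Sv.
have [su lu lu1] := Su; have [sv lv lv1] := Sv.
set f := fun x => _; have tf : tame a b f.
  by apply: tameB; exact: tameM.
have /andP[at_ tb] := It.
have [s Is s_lim] := left_end_seq at_.
have s_end : s n @[n --> \oo] --> at_left_end a.
  move=> P /(near_left_end at_)[x0 /andP[ax0 _] HP].
  have := s_lim _ ax0; apply: filterS => n snx0.
  by apply: HP; [have /andP[] := Is n|exact: ltW].
have W0 : wronskian u u1 v v1 (s n) @[n --> \oo] --> u0 * v10 - u10 * v0.
  apply: cvgB; apply: cvgM.
  - exact: (cvg_comp s u s_end lu).
  - exact: (cvg_comp s v1 s_end lv1).
  - exact: (cvg_comp s u1 s_end lu1).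
  - exact: (cvg_comp s v s_end lv).
have E n : wronskian u u1 v v1 (s n) =
    wronskian u u1 v v1 t - wint a w t f + wint a w (s n) f.
  have Isn := Is n; have /andP[_ snt] := Isn.
  have := wint_itv It Isn tf.
  rewrite -(lagrange_compact w_loc su sv tphi tpsi (sub_oitv It Isn) It
    (ltW snt)).
  by move=> ?; lra.
have W1 : wronskian u u1 v v1 (s n) @[n --> \oo] -->
  wronskian u u1 v v1 t - wint a w t f + 0.
  under eq_fun do rewrite E.
  apply: cvgD; [exact: cvg_cst|].
  exact: (wint_left_end It Is s_lim tf).
have := @cvg_unique _ (@Rhausdorff R) _ _ _ _ W0 W1.
by rewrite addr0 => ->; rewrite subrK.
Qed.

End LagrangeEnd.

(** * Comparison of solutions at [xi] and at [xi + i r] *)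

Section KeyEstimate.
Context {R : realType}.
Local Notation mu := (@lebesgue_measure R).
Variables (p q w : R -> R) (a b : \bar R).
Hypothesis w_loc : locally_integrable (oitv a b) w.
Hypothesis w_int : forall t, oitv a b t ->
  mu.-integrable (oitv a t%:E) (EFin \o w).
Hypothesis w_pos : {ae mu, forall x, oitv a b x -> 0 < w x}.

Definition wdot t (f g : R -> R) : R := wint a w t (fun x => f x * g x).
Local Notation tame := (tame a b).

Lemma wdot_linl t k l f g h : oitv a b t -> tame f -> tame g -> tame h ->
  wdot t (fun x => k * f x + l * g x) h = k * wdot t f h + l * wdot t g h.
Proof.
move=> It tf tg th.
have tfh := tameM tf th; have tgh := tameM tg th.
rewrite /wdot -!(wintZ w_int)// -(wintD w_int)//; try exact: tameZ.
by apply: eq_wint => x _; ring.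
Qed.

Lemma wdotC t f g : wdot t f g = wdot t g f.
Proof. by apply: eq_wint => x _; rewrite mulrC. Qed.

Lemma wdot_linr t k l f g h : oitv a b t -> tame f -> tame g -> tame h ->
  wdot t h (fun x => k * f x + l * g x) = k * wdot t h f + l * wdot t h g.
Proof. by move=> It tf tg th; rewrite wdotC wdot_linl// !(wdotC _ h). Qed.

Lemma wdot_ge0 t f : oitv a b t -> tame f -> 0 <= wdot t f f.
Proof.
move=> It tf; apply: (wint_ge0 w_int w_pos It); first exact: tameM.
by move=> x _; rewrite -expr2 sqr_ge0.
Qed.

Lemma wdot_mono s t f : oitv a b t -> oitv a t%:E s -> tame f ->
  wdot s f f <= wdot t f f.
Proof.
move=> It Is tf; apply: (wint_mono w_int w_pos It Is); first exact: tameM.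
by move=> x _; rewrite -expr2 sqr_ge0.
Qed.

Lemma wdot_sqr_lin t k l f g : oitv a b t -> tame f -> tame g ->
  wdot t (fun x => k * f x + l * g x) (fun x => k * f x + l * g x) =
  k ^+ 2 * wdot t f f + 2 * k * l * wdot t f g + l ^+ 2 * wdot t g g.
Proof.
move=> It tf tg.
have th : tame (fun x => k * f x + l * g x) by apply: tameD; exact: tameZ.
rewrite wdot_linl// wdotC wdot_linl// [X in _ + l * X]wdotC wdot_linl//.
by rewrite (wdotC _ g f); ring.
Qed.

Lemma wdot_cauchy_schwarz t f g : oitv a b t -> tame f -> tame g ->
  wdot t f g ^+ 2 <= wdot t f f * wdot t g g.
Proof.
move=> It tf tg.
have P k l : 0 <= k ^+ 2 * wdot t f f + 2 * k * l * wdot t f g +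
  l ^+ 2 * wdot t g g.
  rewrite -wdot_sqr_lin//; apply: wdot_ge0 => //.
  by apply: tameD; exact: tameZ.
have F0 := wdot_ge0 It tf; have G0 := wdot_ge0 It tg.
(* If |g| = 0, the form in P is affine in l, so it can be made negative unless
   (f, g) = 0. *)
have [G|G] := eqVneq (wdot t g g) 0.
  rewrite G mulr0.
  have [-> |H] := eqVneq (wdot t f g) 0; first by rewrite expr0n.
  have := P (wdot t f g) (- (wdot t f f + 1)/2 ); rewrite G.
  have H2 : 0 < wdot t f g ^+ 2 by rewrite exprn_even_gt0.
  set A := wdot t f f in F0 *; set B := wdot t f g in H2 *.
  have -> : B ^+ 2 * A + 2 * B * (- (A + 1) / 2) * B +
    (- (A + 1) / 2) ^+ 2 * 0 = - B ^+ 2.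
    by field.
  by lra.
have := P (wdot t g g) (- wdot t f g).
have {}G : 0 < wdot t g g by rewrite lt_def G.
set A := wdot t f f in F0 *; set B := wdot t f g; set D := wdot t g g in G0 G *.
have -> : D ^+ 2 * A + 2 * D * - B * B + (- B) ^+ 2 * D = D * (A * D - B ^+ 2)
  by ring.
by rewrite pmulr_rge0// subr_ge0.
Qed.

Variables (xi r : R).
Variables (C C1 S S1 : R -> R).
Hypothesis solC : real_ivp p q w a b C C1 (fun x => xi * C x) 1 0.
Hypothesis solS : real_ivp p q w a b S S1 (fun x => xi * S x) 0 1.

Let tC : tame C := (real_ivp_tame solC).1.
Let tS : tame S := (real_ivp_tame solS).1.

Lemma wronskian_CS x : oitv a b x -> wronskian C C1 S S1 x = 1.
Proof.
move=> Ix; rewrite (lagrange_identity w_loc w_int solC solS)//;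
  try exact: tameZ.
rewrite mul0r subr0 mulr1 (_ : (fun x => _) = fun x => 0 * C x).
  by rewrite (wintZ w_int)// mul0r addr0.
by apply/funext => y; ring.
Qed.

(** [C W(f, S) + S W(C, f) = f W(C, S) = f], and Lagrange's identity computes
    the two Wronskians from the initial values of [f] and the inhomogeneity
    [g]. *)
Lemma variation_of_constants f f1 g f0 f10 x : tame g ->
  real_ivp p q w a b f f1 (fun y => xi * f y + g y) f0 f10 -> oitv a b x ->
  f x = f0 * C x + f10 * S x + (C x * wdot x g S - S x * wdot x g C).
Proof.
move=> tg sf Ix.
have tf : tame f := (real_ivp_tame sf).1.
have := wronskian_CS Ix.
have := lagrange_identity w_loc w_int solC sf (tameZ xi tC)
  (tameD (tameZ xi tf) tg) Ix.
have := lagrange_identity w_loc w_int sf solS (tameD (tameZ xi tf) tg)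
  (tameZ xi tS) Ix.
have -> : wint a w x (fun y => (xi * f y + g y) * S y - f y * (xi * S y)) =
  wdot x g S.
  by apply: eq_wint => y _; ring.
have -> : wint a w x (fun y => xi * C y * f y - C y * (xi * f y + g y)) =
  - wdot x g C.
  rewrite -mulN1r -(wintZ w_int)//; last exact: tameM.
  by apply: eq_wint => y _; ring.
rewrite /wronskian => E1 E2 E3.
have -> : f x = C x * (f x * S1 x - f1 x * S x) +
  S x * (C x * f1 x - C1 x * f x).
  by rewrite -[LHS]mulr1 -E3; ring.
by rewrite E1 E2; ring.
Qed.

Definition gram t := wdot t C C * wdot t S S - wdot t C S ^+ 2.

(** The correction term at [x] is the scalar product over [(a, x)] of [g] with
    the kernel [C(x) S - S(x) C]; Cauchy-Schwarz applies, and both norms only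
    grow when [(a, x)] is enlarged to [(a, t)]. *)
Lemma variation_sqr_bound g t x : tame g -> oitv a b t -> oitv a t%:E x ->
  (C x * wdot x g S - S x * wdot x g C) ^+ 2 <=
  (C x ^+ 2 * wdot t S S - 2 * C x * S x * wdot t C S + S x ^+ 2 * wdot t C C)
    * wdot t g g.
Proof.
move=> tg It Ix; have Ix' := sub_oitv It Ix.
pose k y := C x * S y + (- S x) * C y.
have tk : tame k by apply: tameD; exact: tameZ.
have -> : C x * wdot x g S - S x * wdot x g C = wdot x k g.
  by rewrite /k wdot_linl// !(wdotC x _ g); ring.
have -> : C x ^+ 2 * wdot t S S - 2 * C x * S x * wdot t C S +
  S x ^+ 2 * wdot t C C =
  wdot t k k.
  by rewrite /k wdot_sqr_lin// (wdotC t S C); ring.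
apply: le_trans (wdot_cauchy_schwarz Ix' tk tg) _.
by apply: ler_pM; rewrite ?wdot_ge0// wdot_mono.
Qed.

Lemma wint_kernel t : oitv a b t ->
  wint a w t (fun x => C x ^+ 2 * wdot t S S - 2 * C x * S x * wdot t C S
    + S x ^+ 2 * wdot t C C) = 2 * gram t.
Proof.
move=> It.
set A := wdot t C C; set B := wdot t C S; set D := wdot t S S.
have -> : 2 * gram t = D * A + (- (2 * B) * B + A * D)
  by rewrite /gram -/A -/B -/D; ring.
have tCC := tameM tC tC; have tSS := tameM tS tS; have tCS := tameM tC tS.
have tt := tameD (tameZ (- (2 * B)) tCS) (tameZ A tSS).
have := wintD w_int It (tameZ D tCC) tt.
rewrite (wintD w_int It (tameZ _ tCS) (tameZ _ tSS)) !(wintZ w_int)// => <-.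
by apply: eq_wint => y _; ring.
Qed.

Variables (f f1 g g1 : R -> R) (f0 f10 g0 g10 : R).
Hypothesis solf : real_ivp p q w a b f f1 (fun x => xi * f x - r * g x) f0 f10.
Hypothesis solg : real_ivp p q w a b g g1 (fun x => xi * g x + r * f x) g0 g10.

Let tf : tame f := (real_ivp_tame solf).1.
Let tg : tame g := (real_ivp_tame solg).1.

(** The main estimate.  The combination [f0 C + f10 S] is [f] minus its
    correction term, whose square is bounded by [variation_sqr_bound] and
    integrated by [wint_kernel]; the same holds for [g].  As the correction term
    of [f] involves [g] and conversely, only the sum of the two bounds is
    a multiple of [|f|^2 + |g|^2]. *)
Lemma energy_comparison t : oitv a b t ->
  wdot t (fun x => f0 * C x + f10 * S x) (fun x => f0 * C x + f10 * S x) +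
  wdot t (fun x => g0 * C x + g10 * S x) (fun x => g0 * C x + g10 * S x) <=
  (2 + 4 * r ^+ 2 * gram t) * (wdot t f f + wdot t g g).
Proof.
move=> It.
pose kap x := C x ^+ 2 * wdot t S S - 2 * C x * S x * wdot t C S +
  S x ^+ 2 * wdot t C C.
have tkap : tame kap.
  apply: tameD; [apply: tameB|]; apply: tameM; try exact: tame_cst.
  - exact: tameX.
  - by apply: tameM => //; apply: tameM => //; exact: tame_cst.
  - exact: tameX.
have one h h1 k c h0 h10 : tame k ->
    real_ivp p q w a b h h1 (fun x => xi * h x + c * k x) h0 h10 ->
    wdot t (fun x => h0 * C x + h10 * S x) (fun x => h0 * C x + h10 * S x) <=
    2 * wdot t h h + 4 * c ^+ 2 * gram t * wdot t k k.
  move=> tk sh.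
  have th : tame h := (real_ivp_tame sh).1.
  set N := wdot t k k.
  have thh := tameM th th.
  have -> : 2 * wdot t h h = wint a w t (fun x => 2 * (h x * h x)).
    by rewrite (wintZ w_int).
  have -> : 4 * c ^+ 2 * gram t * N =
    wint a w t (fun x => 2 * c ^+ 2 * N * kap x).
    by rewrite (wintZ w_int)// wint_kernel//; ring.
  have tkk := tameZ (2 * c ^+ 2 * N) tkap.
  rewrite -(wintD w_int It)//; last exact: tameZ.
  apply: (wint_le w_int w_pos It).
  - by apply: tameM; apply: tameD; exact: tameZ.
  - by apply: tameD => //; exact: tameZ.
  move=> x Ix /=.
  have Ix' := sub_oitv It Ix.
  have Eh := variation_of_constants (tameZ c tk) sh Ix'.
  have := variation_sqr_bound tk It Ix; rewrite -/(kap x) -/N.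
  have Z e : tame e -> wdot x (fun y => c * k y) e = c * wdot x k e.
    move=> te; rewrite -(wintZ w_int)//; last exact: tameM.
    by apply: eq_wint => y _; rewrite mulrA.
  rewrite !Z// in Eh.
  set V := C x * wdot x k S - S x * wdot x k C => hV.
  have -> : h0 * C x + h10 * S x = h x - c * V by rewrite Eh /V; ring.
  have : c ^+ 2 * V ^+ 2 <= c ^+ 2 * (kap x * N).
    by rewrite ler_wpM2l// sqr_ge0.
  have : 0 <= (h x + c * V) ^+ 2 by rewrite sqr_ge0.
  by move=> ? ?; nra.
have solf' : real_ivp p q w a b f f1 (fun x => xi * f x + - r * g x) f0 f10.
  by under [X in real_ivp _ _ _ _ _ _ _ X]eq_fun do rewrite mulNr.
have := lerD (one f f1 g (- r) f0 f10 tg solf') (one g g1 f r g0 g10 tf solg).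
by rewrite sqrrN => /le_trans; apply; rewrite le_eqVlt; apply/orP; left;
  apply/eqP; ring.
Qed.

End KeyEstimate.

(** * Weyl discs *)

Section NestedDiscs.
Context {R : realType}.

Lemma nested_closed_inter (E : nat -> set (R * R)) (l1 u1 l2 u2 : R) :
  (forall n, closed (E n)) -> (forall m n, (m <= n)%N -> E n `<=` E m) ->
  (forall n, E n !=set0) -> E 0%N `<=` `[l1, u1] `*` `[l2, u2] ->
  exists z, forall n, E n z.
Proof.
move=> cE nE E0 Eb.
pose x n : R * R := projT1 (cid (E0 n)).
have xE n : E n (x n) by exact: projT2 (cid (E0 n)).
have K : compact (`[l1, u1]%classic `*` `[l2, u2]%classic : set (R * R)).
  by apply: compact_setX; exact: segment_compact.
have [//|] := K (x @ \oo) _.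
  exists 0%N => // n _; apply: Eb; exact: (nE 0%N n (leq0n n) _ (xE n)).
move=> z [_ zx]; exists z => n.
apply: cE => U Uz.
have /zx /(_ Uz)[y [Ey Uy]] : (x @ \oo) (E n).
  exists n => // m nm; exact: (nE n m nm _ (xE m)).
by exists y.
Qed.

(** For [|c|^2 = A], [(c, s) = B1 + i B2] and [|s|^2 = D] this is the set of the
    [u = u.1 + i u.2] with [|c + u s|^2 <= Im u / r]. *)
Definition disc (r A B1 B2 D : R) : set (R * R) :=
  [set u | A + 2 * (u.1 * B1 + u.2 * B2) + (u.1 ^+ 2 + u.2 ^+ 2) * D <=
    u.2 / r].

Lemma disc_closed r A B1 B2 D : closed (disc r A B1 B2 D).
Proof.
have c1 : continuous (fun u : R * R => u.1) by move=> u; exact: cvg_fst.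
have c2 : continuous (fun u : R * R => u.2) by move=> u; exact: cvg_snd.
pose F (u : R * R) :=
  A + 2 * (u.1 * B1 + u.2 * B2) + (u.1 ^+ 2 + u.2 ^+ 2) * D - u.2 / r.
have cF : continuous F.
  move=> u; rewrite /F.
  apply: cvgB; last by apply: cvgM; [exact: c2|exact: cvg_cst].
  apply: cvgD.
    apply: cvgD; first exact: cvg_cst.
    apply: cvgM; first exact: cvg_cst.
    by apply: cvgD; apply: cvgM; try exact: cvg_cst; [exact: c1|exact: c2].
  apply: cvgM; last exact: cvg_cst.
  by apply: cvgD; rewrite !expr2; apply: cvgM; try exact: c1; exact: c2.
rewrite (_ : disc r A B1 B2 D = F @^-1` [set x | x <= 0]); last first.
  by apply/seteqP; split=> u; rewrite /disc /F /= subr_le0.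
by apply: closed_comp => [u _|]; [exact: cF|exact: closed_le].
Qed.

Lemma disc_bounded r A B1 B2 D : 0 < D ->
  exists l1 u1 l2 u2, disc r A B1 B2 D `<=` `[l1, u1] `*` `[l2, u2].
Proof.
move=> D0.
(* Completing the square: the disc has centre (m1, m2) and squared radius
   M - 1, and |x| <= 1 + x^2 turns this into a box. *)
pose m1 := - B1 / D; pose m2 := - (B2 - r^-1 / 2) / D.
pose M := m1 ^+ 2 + m2 ^+ 2 - A / D + 1.
exists (m1 - M - 1), (m1 + M + 1), (m2 - M - 1), (m2 + M + 1) => -[x y].
rewrite /disc /= => H.
have {}H : (x - m1) ^+ 2 + (y - m2) ^+ 2 <= M - 1.
  rewrite -(ler_pM2r D0).
  have -> : (M - 1) * D = (m1 ^+ 2 + m2 ^+ 2) * D - A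
    by rewrite /M; field; rewrite gt_eqF.
  have e1 : m1 * D = - B1 by rewrite /m1 divfK// gt_eqF.
  have e2 : m2 * D = - (B2 - r^-1 / 2) by rewrite /m2 divfK// gt_eqF.
  have -> : ((x - m1) ^+ 2 + (y - m2) ^+ 2) * D =
    (x ^+ 2 + y ^+ 2) * D - 2 * (x * (m1 * D) + y * (m2 * D)) +
      (m1 ^+ 2 + m2 ^+ 2) * D by ring.
  by rewrite e1 e2; lra.
have h1 := sqr_ge0 (x - m1); have h2 := sqr_ge0 (y - m2).
by split=> /=; rewrite in_itv/=; apply/andP; split; nra.
Qed.

End NestedDiscs.

Section Exhaustion.
Context {R : realType}.
Local Notation mu := (@lebesgue_measure R).

Lemma integrable_exhaust (F : nat -> set R) (D : set R) (h : R -> R) (M : R) :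
  nondecreasing_seq F -> (forall n, measurable (F n)) -> D = \bigcup_n F n ->
  measurable_fun D h ->
  (forall n, (\int[mu]_(x in F n) `|h x|%:E <= M%:E)%E) ->
  mu.-integrable D (EFin \o h).
Proof.
move=> ndF mF DE mh FM.
have mD : measurable D by rewrite DE; exact: bigcup_measurable.
apply/integrableP; split; first exact/measurable_EFinP.
have mh' n : measurable_fun (F n) (fun x => `|h x|%:E).
  apply/measurable_EFinP; apply: measurableT_comp => //.
  by apply: measurable_funS mh => //; rewrite DE; exact: bigcup_sup.
have h0 n x : F n x -> (0 <= `|h x|%:E)%E by rewrite lee_fin.
have cvgh := @ge0_nondecreasing_set_cvg_integral _ (measurableTypeR R) R F
  (fun x => `|h x|%:E) mu ndF mF mh' h0.
apply: (@le_lt_trans _ _ M%:E); last by rewrite ltry.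
rewrite DE -(cvg_lim _ cvgh)//.
apply: lime_le; first by apply: cvgP; exact: cvgh.
by apply: nearW => n; exact: FM.
Qed.

End Exhaustion.

Section Weyl.
Context {R : realType}.
Local Notation mu := (@lebesgue_measure R).
Variables (p q w : R -> R) (a b : \bar R).
Hypothesis w_loc : locally_integrable (oitv a b) w.
Hypothesis w_int : forall t, oitv a b t ->
  mu.-integrable (oitv a t%:E) (EFin \o w).
Hypothesis w_pos : {ae mu, forall x, oitv a b x -> 0 < w x}.
Local Notation wdot := (wdot w a).
Local Notation real_ivp := (real_ivp p q w a b).
Local Notation tame := (tame a b).

Variables (xi r : R).

(** [f + i g] solves the equation at [xi + i r] with initial values
    [f0 + i g0] and [f10 + i g10]. *)
Definition split_ivp f f1 g g1 (f0 f10 g0 g10 : R) : Prop :=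
  real_ivp f f1 (fun x => xi * f x - r * g x) f0 f10 /\
  real_ivp g g1 (fun x => xi * g x + r * f x) g0 g10.

(** Lagrange's identity for a solution and its complex conjugate. *)
Lemma green f f1 g g1 f0 f10 g0 g10 t :
  split_ivp f f1 g g1 f0 f10 g0 g10 -> oitv a b t ->
  wronskian f f1 g g1 t = f0 * g10 - f10 * g0 - r * (wdot t f f + wdot t g g).
Proof.
move=> [sf sg] It.
have [tf _] := real_ivp_tame sf; have [tg _] := real_ivp_tame sg.
rewrite (lagrange_identity w_loc w_int sf sg)//; first last.
- by apply: tameD; exact: tameZ.
- by apply: tameB; exact: tameZ.
congr (_ + _); rewrite -mulNr -(wintD w_int)//; try exact: tameM.
rewrite -(wintZ w_int)//; last by apply: tameD; exact: tameM.
by apply: eq_wint => x _; ring.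
Qed.

Variables (cr cr1 ci ci1 sr sr1 si si1 : R -> R).
Hypothesis solc : split_ivp cr cr1 ci ci1 1 0 0 0.
Hypothesis sols : split_ivp sr sr1 si si1 0 1 0 0.

Let tcr : tame cr := (real_ivp_tame solc.1).1.
Let tci : tame ci := (real_ivp_tame solc.2).1.
Let tsr : tame sr := (real_ivp_tame sols.1).1.
Let tsi : tame si := (real_ivp_tame sols.2).1.

(** [combo_re u + i combo_im u] is [c + u s] for [u = u.1 + i u.2], and
    [combo_re1 u + i combo_im1 u] is its quasi-derivative. *)
Definition combo_re (u : R * R) x := cr x + (u.1 * sr x - u.2 * si x).
Definition combo_im (u : R * R) x := ci x + (u.1 * si x + u.2 * sr x).
Definition combo_re1 (u : R * R) x := cr1 x + (u.1 * sr1 x - u.2 * si1 x).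
Definition combo_im1 (u : R * R) x := ci1 x + (u.1 * si1 x + u.2 * sr1 x).

Lemma combo_ivp u : split_ivp (combo_re u) (combo_re1 u) (combo_im u)
  (combo_im1 u) 1 u.1 0 u.2.
Proof.
have [c1 c2] := solc; have [s1 s2] := sols.
split.
- have := real_ivp_lin 1 1 c1 (real_ivp_lin u.1 (- u.2) s1 s2).
  rewrite (_ : (fun x => 1 * cr x + _) = combo_re u);
    last by apply/funext => x; rewrite /combo_re; ring.
  rewrite (_ : (fun x => 1 * cr1 x + _) = combo_re1 u);
    last by apply/funext => x; rewrite /combo_re1; ring.
  rewrite (_ : (fun x => 1 * (xi * cr x - r * ci x) + _) =
    fun x => xi * combo_re u x - r * combo_im u x); last first.
    by apply/funext => x; rewrite /combo_re /combo_im; ring.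
  by rewrite !(mulr0, mulr1, mul1r, addr0, add0r).
- have := real_ivp_lin 1 1 c2 (real_ivp_lin u.1 u.2 s2 s1).
  rewrite (_ : (fun x => 1 * ci x + _) = combo_im u);
    last by apply/funext => x; rewrite /combo_im; ring.
  rewrite (_ : (fun x => 1 * ci1 x + _) = combo_im1 u);
    last by apply/funext => x; rewrite /combo_im1; ring.
  rewrite (_ : (fun x => 1 * (xi * ci x + r * cr x) + _) =
    fun x => xi * combo_im u x + r * combo_re u x); last first.
    by apply/funext => x; rewrite /combo_re /combo_im; ring.
  by rewrite !(mulr0, mulr1, mul1r, addr0, add0r).
Qed.

Let tcombo_re u : tame (combo_re u).
Proof. exact: (real_ivp_tame (combo_ivp u).1).1. Qed.
Let tcombo_im u : tame (combo_im u).
Proof. exact: (real_ivp_tame (combo_ivp u).2).1. Qed.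

Definition weyl_disc t : set (R * R) :=
  disc r (wdot t cr cr + wdot t ci ci)
    (wdot t cr sr + wdot t ci si) (wdot t ci sr - wdot t cr si)
    (wdot t sr sr + wdot t si si).

Lemma weyl_discE t u : oitv a b t -> weyl_disc t u <->
  wdot t (combo_re u) (combo_re u) + wdot t (combo_im u) (combo_im u) <=
    u.2 / r.
Proof.
move=> It; rewrite /weyl_disc /disc /=.
rewrite (_ : wdot t (combo_re u) (combo_re u) + _ =
  wdot t cr cr + wdot t ci ci +
   2 * (u.1 * (wdot t cr sr + wdot t ci si) +
     u.2 * (wdot t ci sr - wdot t cr si)) +
   (u.1 ^+ 2 + u.2 ^+ 2) * (wdot t sr sr + wdot t si si))//.
have -> : combo_re u = fun x => 1 * cr x + 1 * (u.1 * sr x + - u.2 * si x).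
  by apply/funext => x; rewrite /combo_re; ring.
have -> : combo_im u = fun x => 1 * ci x + 1 * (u.1 * si x + u.2 * sr x).
  by apply/funext => x; rewrite /combo_im; ring.
have t1 : tame (fun x => u.1 * sr x + - u.2 * si x)
  by apply: tameD; exact: tameZ.
have t2 : tame (fun x => u.1 * si x + u.2 * sr x) by apply: tameD; exact: tameZ.
rewrite !(wdot_sqr_lin w_int _ _ It)// !(wdot_linr w_int _ _ It)//.
by rewrite (wdotC _ _ t si sr); ring.
Qed.

Lemma weyl_disc_nested s t : oitv a b t -> oitv a t%:E s ->
  weyl_disc t `<=` weyl_disc s.
Proof.
move=> It Is u /(weyl_discE _ It) H; apply/(weyl_discE _ (sub_oitv It Is)).
apply: le_trans H; apply: lerD; exact: (wdot_mono w_int w_pos It Is).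
Qed.

(** The point is [u = - c(t) / s(t)].  The denominator does not vanish, since
    Green's identity would give [|s| = 0] otherwise; and for a solution that
    vanishes at [t] Green's identity is the equality [Im u = r |c + u s|^2]. *)
Lemma weyl_disc_nonempty t : oitv a b t -> r != 0 ->
  0 < wdot t sr sr + wdot t si si -> weyl_disc t !=set0.
Proof.
move=> It r0 Ns.
have Ws := green sols It.
have d0 : sr t ^+ 2 + si t ^+ 2 != 0.
  apply/negP; rewrite paddr_eq0 ?sqr_ge0// !sqrf_eq0 => /andP[/eqP e1 /eqP e2].
  move: Ws; rewrite /wronskian e1 e2 !(mul0r, mulr0, subr0) sub0r => /eqP.
  by rewrite eq_sym oppr_eq0 mulf_eq0 (negbTE r0) gt_eqF.
set d := sr t ^+ 2 + si t ^+ 2 in d0.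
pose u := (- (cr t * sr t + ci t * si t) / d,
  - (ci t * sr t - cr t * si t) / d).
exists u; apply/(weyl_discE _ It).
have e1 : combo_re u t = 0.
  have -> : combo_re u t = (cr t * d - (cr t * sr t + ci t * si t) * sr t
      + (ci t * sr t - cr t * si t) * si t) / d by rewrite /combo_re /u /=;
          field.
  by rewrite [X in X / d](_ : _ = 0) ?mul0r// /d; ring.
have e2 : combo_im u t = 0.
  have -> : combo_im u t = (ci t * d - (cr t * sr t + ci t * si t) * si t
      - (ci t * sr t - cr t * si t) * sr t) / d by rewrite /combo_im /u /=;
          field.
  by rewrite [X in X / d](_ : _ = 0) ?mul0r// /d; ring.
have := green (combo_ivp u) It; rewrite /wronskian e1 e2 => E.
have -> : u.2 = r *
  (wdot t (combo_re u) (combo_re u) + wdot t (combo_im u) (combo_im u)) by lra.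
by rewrite mulrAC mulfV// mul1r.
Qed.

(** The intersection of the discs along a sequence tending to [b] is nonempty by
    compactness.  The bound on the integrals over [(a, t)] is uniform in [t], so
    it passes to [(a, b)]. *)
Lemma weyl_point t0 : oitv a b t0 -> r != 0 ->
  0 < wdot t0 sr sr + wdot t0 si si ->
  exists u : R * R, (forall t, oitv a b t ->
     wdot t (combo_re u) (combo_re u) + wdot t (combo_im u) (combo_im u) <=
       u.2 / r) /\
   mu.-integrable (oitv a b)
     (EFin \o (fun x => (combo_re u x ^+ 2 + combo_im u x ^+ 2) * w x)).
Proof.
move=> It0 r0 N0; have /andP[at0 t0b] := It0.
have [T [ndT t0T Tb T_lim]] := right_end_seq t0b.
have IT n : oitv a b (T n).
  by rewrite /oitv/= Tb andbT (lt_le_trans at0)// lee_fin.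
have mono f s t : oitv a b t -> oitv a b s -> s <= t -> tame f ->
  wdot s f f <= wdot t f f.
  move=> It Is; rewrite le_eqVlt => /predU1P[-> //|st] tf.
  apply: (wdot_mono w_int w_pos It) => //.
  by have /andP[as_ _] := Is; rewrite /oitv/= as_.
have nest s t : oitv a b t -> oitv a b s -> s <= t ->
  weyl_disc t `<=` weyl_disc s.
  move=> It Is; rewrite le_eqVlt => /predU1P[-> //|st].
  by apply: weyl_disc_nested => //; have /andP[as_ _] := Is;
    rewrite /oitv/= as_.
have NT n : 0 < wdot (T n) sr sr + wdot (T n) si si.
  by apply: lt_le_trans N0 _; apply: lerD; apply: mono.
have [l1 [u1 [l2 [u2 bd]]]] := disc_bounded r
  (wdot (T 0%N) cr cr + wdot (T 0%N) ci ci)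
  (wdot (T 0%N) cr sr + wdot (T 0%N) ci si)
    (wdot (T 0%N) ci sr - wdot (T 0%N) cr si) (NT 0%N).
have [u uE] := @nested_closed_inter R (fun n => weyl_disc (T n)) l1 u1 l2 u2
  (fun n => @disc_closed _ _ _ _ _ _)
  (fun m n mn => nest _ _ (IT n) (IT m) (ndT _ _ mn))
  (fun n => weyl_disc_nonempty (IT n) r0 (NT n)) bd.
have uall t : oitv a b t ->
     wdot t (combo_re u) (combo_re u) + wdot t (combo_im u) (combo_im u) <=
       u.2 / r.
  move=> It; have /andP[_ tb] := It.
  have [n _ /(_ n (leqnn n)) tT] := T_lim _ tb.
  by apply/weyl_discE => //; apply: nest (uE n) => //; exact: ltW.
exists u; split => //.
pose h x := (combo_re u x ^+ 2 + combo_im u x ^+ 2) * w x.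
have mh : measurable_fun (oitv a b) h.
  apply: measurable_funM; last by case: w_loc.
  by apply: tame_measurable; apply: tameD; exact: tameX.
have union : oitv a b = \bigcup_n oitv a (T n)%:E.
  apply/seteqP; split=> x.
    move=> /andP[ax xb]; have [n _ /(_ n (leqnn n)) xT] := T_lim _ xb.
    by exists n => //; rewrite /oitv/= ax lte_fin.
  by case=> n _; exact: (sub_oitv (IT n)).
apply: (integrable_exhaust _ _ union mh (M := u.2 / r)).
- apply/nondecreasing_seqP => n; apply/subsetPset => x /andP[ax xT].
  by rewrite /oitv/= ax (lt_le_trans xT)// lee_fin ndT.
- by move=> n; exact: measurable_oitv.
- move=> n.
  have th : tame (fun x => combo_re u x ^+ 2 + combo_im u x ^+ 2)
    by apply: tameD; exact: tameX.
  have := wint_abs w_int w_pos (IT n) th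
    (fun x _ => addr_ge0 (sqr_ge0 _) (sqr_ge0 _)).
  rewrite -/(h) => <-.
  rewrite -EFin_Rintegral;
    [|exact: measurable_oitv|exact: (tame_integrable w_int (IT n) th)].
  rewrite lee_fin; apply: le_trans (uall _ (IT n)).
  rewrite -[leLHS]/(wint a w (T n)
    (fun x => combo_re u x ^+ 2 + combo_im u x ^+ 2)).
  rewrite (wintD w_int (IT n)); [|exact: tameX..].
  by rewrite /wdot; under eq_wint do rewrite expr2;
    under [X in _ + X]eq_wint do rewrite expr2.
Qed.

End Weyl.

(** * Integrability of the weight at the limit circle endpoint *)

Section WeightIntegrable.
Context {R : realType}.
Local Notation mu := (@lebesgue_measure R).
Variables (w : R -> R) (a b : \bar R).
Hypothesis w_loc : locally_integrable (oitv a b) w.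

Lemma normc_sqr (z : R[i]) : Normc.normc z ^+ 2 =
  complex.Re z ^+ 2 + complex.Im z ^+ 2.
Proof. by case: z => x y /=; rewrite sqr_sqrtr// addr_ge0// sqr_ge0. Qed.

(** Near [a] the weight is at most [(2 / |l|)^2 |y|^2 w]; away from [a] it is
    locally integrable. *)
Lemma weight_integrable (y : R -> R[i]) (l : R) t0 : l != 0 -> oitv a b t0 ->
  in_L2 w (oitv a t0%:E) y ->
  (@complex.Re R \o y) x @[x --> at_left_end a] --> l ->
  forall t, oitv a b t -> mu.-integrable (oitv a t%:E) (EFin \o w).
Proof.
move=> l0 It0 [_ _ Iy] yl t It; have /andP[at0 _] := It0.
have mw : measurable_fun (oitv a b) w by case: w_loc.
have mO c d : measurable (oitv c d : set R) by exact: measurable_oitv.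
have : \forall x \near at_left_end a, `|l| / 2 < `|complex.Re (y x)|.
  by apply: (cvgr_gt `|l|);
    [exact: (cvg_norm yl)|rewrite ltr_pdivrMr// ltr_pMr ?normr_gt0// ltr1n].
move=> /(near_left_end at0)[x0 Ix0 Hx0].
have Ix0' := sub_oitv It0 Ix0.
have I1 : mu.-integrable (oitv a x0%:E) (EFin \o w).
  have Iy' : mu.-integrable (oitv a x0%:E)
    (fun x => (Normc.normc (y x) ^+ 2 * w x)%:E).
    by apply: integrableS Iy; [exact: mO|exact: mO|exact: sub_oitv].
  pose k := (`|l| / 2) ^+ 2.
  have k0 : 0 < k by rewrite exprn_gt0// divr_gt0// normr_gt0.
  apply: (@le_integrable _ _ _ mu _ (mO _ _) _
    (fun x => (k^-1)%:E * (Normc.normc (y x) ^+ 2 * w x)%:E)%E).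
  - by apply/measurable_EFinP; apply: measurable_funS mw;
      [exact: mO|exact: sub_oitv].
  - move=> x /andP[ax xx0].
    have : k <= Normc.normc (y x) ^+ 2.
      rewrite normc_sqr.
      apply: (@le_trans _ _ (`|complex.Re (y x)| ^+ 2)).
        rewrite ler_sqr ?nnegrE ?divr_ge0//.
        by apply: ltW; apply: Hx0 => //; rewrite ltW.
      by rewrite real_normK ?num_real// lerDl sqr_ge0.
    move: (Normc.normc (y x) ^+ 2) => N kN;
      rewrite /= lee_fin !normrM mulrA ler_peMl//.
    rewrite mulrC [`|k^-1|]ger0_norm ?invr_ge0 ?(ltW k0)// ler_pdivlMr// mul1r.
    by rewrite (le_trans kN)// ler_norm.
  - exact: (@integrableZl _ _ _ mu _ (mO _ _) _ _ Iy').
have [tx0|x0t] := leP t x0.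
  apply: integrableS I1; [exact: mO|exact: mO|move=> x /andP[ax xt]].
  by rewrite /oitv/= ax (lt_le_trans xt).
have I2 : mu.-integrable `[x0, t] (EFin \o w)
  by exact: locally_integrable_itv w_loc.
apply/integrableP; split.
  by apply/measurable_EFinP; apply: measurable_funS mw;
    [exact: mO|exact: sub_oitv].
apply: (@le_lt_trans _ _
  (\int[mu]_(x in oitv a x0%:E `|` `[x0, t]) `|(EFin \o w) x|)%E).
  apply: ge0_subset_integral => //; try exact: mO.
  - by apply: measurableU => //; exact: mO.
  - apply: measurableT_comp => //; apply/measurable_EFinP.
    apply: measurable_funS mw; [exact: mO|move=> x [/(sub_oitv Ix0')//|]].
    exact: oitv_itv.
  - move=> x /andP[ax xt]; have [xx0|x0x] := ltP x x0.
      by left; rewrite /oitv/= ax lte_fin.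
    by right; rewrite /= in_itv/= x0x ltW.
rewrite ge0_integral_setU//.
- by apply: lte_add_pinfty; [case/integrableP: I1|case/integrableP: I2].
- exact: mO.
- apply: measurableT_comp => //; apply/measurable_EFinP.
  apply: measurable_funS mw; [exact: mO|move=> x [/(sub_oitv Ix0')//|]].
  exact: oitv_itv.
- apply/disj_setPS => x [/andP[_ +]] /=;
    rewrite in_itv/= lte_fin => xx0 /andP[].
  by rewrite leNgt xx0.
Qed.

End WeightIntegrable.

(** * Assembling the estimate *)

Section Bridge.
Context {R : realType}.
Variables (p q w : R -> R) (a b : \bar R).

Lemma solution_ivp_split xi r (y : R -> R[i]) (alpha beta : R[i]) :
  solution_ivp p q w a b (xi +i* r) y alpha beta ->
  exists f1 g1, split_ivp p q w a b xi r (@complex.Re R \o y) f1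
    (@complex.Im R \o y) g1
    (complex.Re alpha) (complex.Re beta) (complex.Im alpha) (complex.Im beta).
Proof.
move=> [y1 /solution_qd_real_solution[sr si] [[lr li] [l1r l1i]]].
exists (@complex.Re R \o y1), (@complex.Im R \o y1); split; split => //.
- by move: sr; congr real_solution; apply/funext => x /=; case: (y x).
- by move: si; congr real_solution; apply/funext => x /=; case: (y x).
Qed.

End Bridge.

(** The quadratic inequality satisfied by [m = x + i y] yields all four bounds:
    with [Delta = A D - B^2], the left-hand side [Q = |C + m S|^2] dominates
    [Delta / D], [|m|^2 Delta / A], [y^2 D] and [y^2 A / |m|^2].  After
    multiplication by [D] or [A] the differences are sums of squares and of
    nonnegative multiples of [Delta]. *)
Lemma weyl_bounds (R : realFieldType) (C1 K A B D x y r : R) :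
  0 < C1 -> 0 < K -> 0 < r -> 0 <= A -> 0 <= D ->
  C1 * (1 / r ^+ 2) <= A * D - B ^+ 2 ->
  A + 2 * x * B + (x ^+ 2 + y ^+ 2) * D <= K * (y / r) ->
  C1 / K * (1 / (r * D)) <= y <= K * (1 / (r * D)) /\
  C1 / K * (1 / (r * A)) <= y / (x ^+ 2 + y ^+ 2) <= K * (1 / (r * A)).
Proof.
move=> C0 K0 r0 A0 D0 HD H.
have r2 : 0 < r ^+ 2 by rewrite exprn_gt0.
have De0 : 0 < A * D - B ^+ 2
  by apply: lt_le_trans HD; rewrite mulr_gt0// divr_gt0.
have AD0 : 0 < A * D by rewrite (lt_le_trans De0)// gerBl sqr_ge0.
have {A0}A0 : 0 < A
  by rewrite lt_def A0 andbT; apply: contraTneq AD0 => ->; rewrite mul0r ltxx.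
have {D0}D0 : 0 < D
  by rewrite lt_def D0 andbT; apply: contraTneq AD0 => ->; rewrite mulr0 ltxx.
have {}H : r * (A + 2 * x * B + (x ^+ 2 + y ^+ 2) * D) <= K * y.
  have := ler_wpM2l (ltW r0) H; congr (_ <= _); field; by rewrite gt_eqF.
have {}HD : C1 <= r ^+ 2 * (A * D - B ^+ 2).
  have := ler_wpM2l (ltW r2) HD; congr (_ <= _); field; by rewrite gt_eqF.
set Q := A + _ + _ in H.
have QD : A * D - B ^+ 2 <= Q * D.
  have -> : Q * D = A * D - B ^+ 2 + ((x * D + B) ^+ 2 + (y * D) ^+ 2)
    by rewrite /Q; ring.
  by rewrite lerDl addr_ge0// sqr_ge0.
have QA : (x ^+ 2 + y ^+ 2) * (A * D - B ^+ 2) <= Q * A.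
  have -> : Q * A = (x ^+ 2 + y ^+ 2) * (A * D - B ^+ 2) +
    ((A + x * B) ^+ 2 + (y * B) ^+ 2) by rewrite /Q; ring.
  by rewrite lerDl addr_ge0// sqr_ge0.
have Q0 : 0 < Q by rewrite -(pmulr_lgt0 _ D0) (lt_le_trans De0).
have y0 : 0 < y by rewrite -(pmulr_rgt0 _ K0) (lt_le_trans _ H)// mulr_gt0.
have m0 : 0 < x ^+ 2 + y ^+ 2 by rewrite ltr_wpDl ?sqr_ge0// exprn_gt0.
have h1 : y ^+ 2 * (r * D) <= K * y.
  apply: le_trans H; rewrite mulrCA ler_pM2l//.
  rewrite -(ler_pM2r D0).
  have -> : Q * D = A * D - B ^+ 2 + (x * D + B) ^+ 2 + y ^+ 2 * D * D
    by rewrite /Q; ring.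
  by rewrite lerDr addr_ge0 ?sqr_ge0// ltW.
have h2 : y ^+ 2 * (r * A) <= (x ^+ 2 + y ^+ 2) * (K * y).
  have := ler_wpM2l (ltW m0) H; apply: le_trans.
  rewrite [leLHS]mulrCA [leRHS]mulrCA ler_pM2l//.
  rewrite -(ler_pM2r A0).
  have -> : (x ^+ 2 + y ^+ 2) * Q * A =
    y ^+ 2 * A * A + ((x * A + (x ^+ 2 + y ^+ 2) * B) ^+ 2 +
    (x ^+ 2 + y ^+ 2) ^+ 2 * (A * D - B ^+ 2)) by rewrite /Q; ring.
  by rewrite lerDl addr_ge0 ?sqr_ge0// mulr_ge0 ?sqr_ge0// ltW.
have rD : 0 < r * D by exact: mulr_gt0.
have rA : 0 < r * A by exact: mulr_gt0.
have i1 : C1 <= K * y * (r * D).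
  apply: (le_trans HD); rewrite expr2 -mulrA (mulrC (K * y)) -mulrA ler_pM2l//.
  apply: (@le_trans _ _ (r * (Q * D))); first by rewrite ler_pM2l.
  by rewrite mulrA [leRHS]mulrC ler_pM2r.
have i2 : C1 * (x ^+ 2 + y ^+ 2) <= K * y * (r * A).
  have := ler_wpM2r (ltW m0) HD => /le_trans; apply.
  have := ler_wpM2l (ltW r2) QA;
    rewrite [X in X <= _]mulrCA mulrC => /le_trans; apply.
  have := ler_wpM2r (ltW rA) H; congr (_ <= _); ring.
rewrite !mulrA !mulr1; split; apply/andP; split.
- rewrite ler_pdivrMr// ler_pdivrMr//.
  by rewrite (_ : _ * K = K * y * (r * D))//; ring.
- by rewrite ler_pdivlMr// -(ler_pM2l y0) mulrA -expr2 [leRHS]mulrC.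
- rewrite ler_pdivlMr// mulrAC ler_pdivrMr// mulrAC ler_pdivrMr//.
  by rewrite (_ : _ * K = K * y * (r * A))//; ring.
- rewrite ler_pdivrMr// mulrAC ler_pdivlMr// -(ler_pM2l y0).
  have -> : y * (y * (r * A)) = y ^+ 2 * (r * A) by ring.
  by rewrite (_ : y * (K * _) = (x ^+ 2 + y ^+ 2) * (K * y))//; ring.
Qed.

Section RealEnergy.
Context {R : realType}.
Local Notation mu := (@lebesgue_measure R).
Variables (p q w : R -> R) (a b : \bar R) (xi : R).
Hypothesis w_loc : locally_integrable (oitv a b) w.
Hypothesis w_int : forall t, oitv a b t ->
  mu.-integrable (oitv a t%:E) (EFin \o w).

Lemma split_ivp_real_energy f f1 g g1 f0 f10 :
  split_ivp p q w a b xi 0 f f1 g g1 f0 f10 0 0 ->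
  real_ivp p q w a b f f1 (fun x => xi * f x) f0 f10 /\
  real_ivp p q w a b g g1 (fun x => xi * g x + cst 0 x) 0 0.
Proof.
move=> [sf sg]; split.
  by move: sf; congr real_ivp; apply/funext => x; ring.
by move: sg; congr real_ivp; apply/funext => x; rewrite /= mul0r.
Qed.

Variables (c s : R -> R[i]) (c1 s1 d1 e1 : R -> R).
Hypothesis solc : split_ivp p q w a b xi 0 (@complex.Re R \o c) c1
  (@complex.Im R \o c) d1 1 0 0 0.
Hypothesis sols : split_ivp p q w a b xi 0 (@complex.Re R \o s) s1
  (@complex.Im R \o s) e1 0 1 0 0.

(** The imaginary part solves the equation at [xi] with zero initial values, so
    variation of constants gives zero. *)
Lemma real_energy_Im f f1 g g1 f0 f10 x :
  split_ivp p q w a b xi 0 f f1 g g1 f0 f10 0 0 -> oitv a b x -> g x = 0.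
Proof.
move=> /split_ivp_real_energy[_ sg] Ix.
have [rc _] := split_ivp_real_energy solc;
  have [rs _] := split_ivp_real_energy sols.
rewrite (variation_of_constants w_loc w_int rc rs (tame_cst a b 0) sg Ix).
have Z h : wdot w a x (cst 0) h = 0.
  rewrite /wdot /wint; under eq_Rintegral do rewrite /= !mul0r.
  by rewrite Rintegral_cst ?mul0r//; exact: measurable_oitv.
by rewrite !Z !mul0r !mulr0 subr0 !addr0.
Qed.

Lemma dotp_real t (f g : R -> R[i]) : oitv a b t ->
  (forall x, oitv a b x -> complex.Im (f x) = 0) ->
  (forall x, oitv a b x -> complex.Im (g x) = 0) ->
  dotp w a t f g = (wdot w a t (@complex.Re R \o f) (@complex.Re R \o g))%:C.
Proof.
move=> It f0 g0; rewrite /dotp.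
have E x : oitv a t%:E x -> f x * (g x)^* * (w x)%:C =
  (complex.Re (f x) * complex.Re (g x) * w x)%:C.
  move=> /(sub_oitv It) Ix; have := f0 _ Ix; have := g0 _ Ix.
  case: (f x) (g x) => [u u'] [v v'] /= -> ->.
  by apply/eqP; rewrite eq_complex /=; apply/andP; split; apply/eqP; ring.
apply/eqP; rewrite eq_complex /=; apply/andP; split; apply/eqP.
  by apply: eq_Rintegral => x /set_mem /E ->.
rewrite (_ : Rintegral _ _ _ = \int[mu]_(x in oitv a t%:E) 0); last first.
  by apply: eq_Rintegral => x /set_mem /E ->.
by rewrite Rintegral_cst ?mul0r//; exact: measurable_oitv.
Qed.

End RealEnergy.

Theorem theorem1p2 (R : realType) (C1 C2 : R) (hC1 : 0 < C1) (hC2 : 0 < C2) :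
  exists K1 K2 K3 K4 : R,
    [/\ 0 < K1, 0 < K2, 0 < K3 & 0 < K4] /\
  forall (a b : \bar R) (p q w : R -> R) (c s : R[i] -> R -> R[i])
         (m : R[i] -> R[i]) (xi : R) (that : R -> R),
    (a < b)%E ->
    {ae (@lebesgue_measure R), forall x, oitv a b x -> p x != 0} ->
    locally_integrable (oitv a b) (fun x => (p x)^-1) ->
    locally_integrable (oitv a b) q ->
    locally_integrable (oitv a b) w ->
    {ae (@lebesgue_measure R), forall x, oitv a b x -> 0 < w x} ->
    limit_circle_left p q w a b ->
    limit_point_right p q w a b ->
    (forall z, solution_ivp p q w a b z (c z) 1 0) ->
    (forall z, solution_ivp p q w a b z (s z) 0 1) ->
    weyl_coefficient w a b c s m ->
    (forall r : R, 0 < r -> oitv a b (that r)) ->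
    asymp C1%:C C2%:C
      (fun r => (L2norm w a (that r) (c xi%:C) ^+ 2
                 * L2norm w a (that r) (s xi%:C) ^+ 2)%:C
                - dotp w a (that r) (c xi%:C) (s xi%:C) ^+ 2)
      (fun r => (1 / r ^+ 2)%:C) ->
    asymp K1 K2
      (fun r => complex.Im (m (xi +i* r)))
      (fun r => 1 / (r * L2norm w a (that r) (s xi%:C) ^+ 2)) /\
    asymp K3 K4
      (fun r => complex.Im (m (xi +i* r)) / Normc.normc (m (xi +i* r)) ^+ 2)
      (fun r => 1 / (r * L2norm w a (that r) (c xi%:C) ^+ 2)).
Proof.
pose K := 2 + 4 * C2.
have K0 : 0 < K by rewrite /K addr_gt0// mulr_gt0.
exists (C1 / K), K, (C1 / K), K; split; first by rewrite !divr_gt0.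
move=> a b p q w c s m xi that ab _ _ _ w_loc w_pos lcl _ solc sols weyl Ithat
  gramC.
have w_int : forall t, oitv a b t ->
    (@lebesgue_measure R).-integrable (oitv a t%:E) (EFin \o w).
  have [z0 Hz0] := lcl.
  have [y1 Y1 [[lc _] _]] := solc z0.
  have [|t0 It0 cL2] := Hz0 (c z0); first by exists y1.
  exact: (weight_integrable w_loc (oner_neq0 R) It0 cL2 lc).
have [c1 [d1 cC]] := solution_ivp_split (solc xi%:C).
have [s1 [e1 sS]] := solution_ivp_split (sols xi%:C).
pose C := @complex.Re R \o c xi%:C; pose S := @complex.Re R \o s xi%:C.
have [solC _] := split_ivp_real_energy cC;
  have [solS _] := split_ivp_real_energy sS.
have tC : tame a b C := (real_ivp_tame solC).1.
have tS : tame a b S := (real_ivp_tame solS).1.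
have imc x : oitv a b x -> complex.Im (c xi%:C x) = 0.
  exact: (real_energy_Im w_loc w_int cC sS cC).
have ims x : oitv a b x -> complex.Im (s xi%:C x) = 0.
  exact: (real_energy_Im w_loc w_int cC sS sS).
have normC t : oitv a b t -> L2norm w a t (c xi%:C) ^+ 2 = wdot w a t C C.
  by move=> It; rewrite /L2norm (dotp_real _ It)//= sqr_sqrtr//;
    exact: (wdot_ge0 w_int w_pos It tC).
have normS t : oitv a b t -> L2norm w a t (s xi%:C) ^+ 2 = wdot w a t S S.
  by move=> It; rewrite /L2norm (dotp_real _ It)//= sqr_sqrtr//;
    exact: (wdot_ge0 w_int w_pos It tS).
suff main r : 0 < r ->
    let D := wdot w a (that r) S S in let A := wdot w a (that r) C C in
    let u := m (xi +i* r) in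
    C1 / K * (1 / (r * D)) <= complex.Im u <= K * (1 / (r * D)) /\
    C1 / K * (1 / (r * A)) <=
      complex.Im u / (complex.Re u ^+ 2 + complex.Im u ^+ 2)
      <= K * (1 / (r * A)).
  by split=> r r0; have [H1 H2] := main r r0;
    rewrite ?normC ?normS ?normc_sqr//; exact: Ithat.
move=> r0 D A u.
have It := Ithat r r0; set t := that r in It D A *.
have /andP[g1 g2] : C1 * (1 / r ^+ 2) <= gram w a C S t <= C2 * (1 / r ^+ 2).
  have := gramC r r0; rewrite normC// normS// (dotp_real _ It)//.
  rewrite -/C -/S -/t /gram -rmorphXn -rmorphB -!rmorphM /=.
  by rewrite !lecR.
have [cr1 [ci1 cz]] := solution_ivp_split (solc (xi +i* r)).
have [sr1 [si1 sz]] := solution_ivp_split (sols (xi +i* r)).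
have rg : 4 * r ^+ 2 * gram w a C S t <= 4 * C2.
  rewrite -mulrA ler_pM2l//; have := ler_wpM2l (sqr_ge0 r) g2.
  by rewrite div1r mulrCA mulfV ?mulr1// expf_neq0// gt_eqF.
have A0 : 0 <= A by exact: (wdot_ge0 w_int w_pos It tC).
have D0 : 0 <= D by exact: (wdot_ge0 w_int w_pos It tS).
have keyK f f1 g g1' f0 f10 g0 g10 :
  split_ivp p q w a b xi r f f1 g g1' f0 f10 g0 g10 ->
  f0 ^+ 2 * A + 2 * f0 * f10 * wdot w a t C S + f10 ^+ 2 * D +
  (g0 ^+ 2 * A + 2 * g0 * g10 * wdot w a t C S + g10 ^+ 2 * D) <=
  K * (wdot w a t f f + wdot w a t g g).
  move=> [sf sg].
  rewrite -!(wdot_sqr_lin w_int _ _ It)//.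
  apply: le_trans (energy_comparison w_loc w_int w_pos solC solS sf sg It) _.
  apply: ler_wpM2r; last by rewrite lerD2l.
  by apply: addr_ge0; apply: (wdot_ge0 w_int w_pos It);
    [exact: (real_ivp_tame sf).1|exact: (real_ivp_tame sg).1].
have D1 : 0 < D.
  rewrite lt_def D0 andbT; apply: contraTneq g1 => D00.
  rewrite -ltNge /gram -/A -/D D00 mulr0 sub0r.
  apply: (@le_lt_trans _ _ 0); first by rewrite oppr_le0 sqr_ge0.
  by rewrite mulr_gt0// divr_gt0// exprn_gt0.
(* The comparison applied to s(z, .) bounds its norm below by that of S. *)
have N0 : 0 < wdot w a t (@complex.Re R \o s (xi +i* r))
                         (@complex.Re R \o s (xi +i* r)) +
              wdot w a t (@complex.Im R \o s (xi +i* r))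
                         (@complex.Im R \o s (xi +i* r)).
  rewrite -(pmulr_rgt0 _ K0); apply: lt_le_trans (keyK _ _ _ _ _ _ _ _ sz).
  by rewrite /= !(expr0n, expr1n, mul0r, mulr0, mul1r, add0r, addr0).
(* The point common to all Weyl discs is the Weyl coefficient. *)
have [v [vdisc vint]] :=
  weyl_point w_loc w_int w_pos cz sz It (lt0r_neq0 r0) N0.
have vL2 : in_L2 w (oitv a b)
    (fun x => c (xi +i* r) x + (v.1 +i* v.2) * s (xi +i* r) x).
  have [tre _] := real_ivp_tame (combo_ivp cz sz v).1.
  have [tim _] := real_ivp_tame (combo_ivp cz sz v).2.
  rewrite (_ : (fun x => _) = fun x => combo_re (@complex.Re R \o c (xi +i* r))
    (@complex.Re R \o s (xi +i* r)) (@complex.Im R \o s (xi +i* r)) v x +i*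
    combo_im (@complex.Im R \o c (xi +i* r))
    (@complex.Re R \o s (xi +i* r)) (@complex.Im R \o s (xi +i* r)) v x);
      last first.
    by apply/funext => x; rewrite /combo_re /combo_im /=;
      case: (c _ x) (s _ x) => [? ?] [].
  split; [exact: tame_measurable tre|exact: tame_measurable tim|].
  move: vint; apply: eq_integrable => [|x _]; first exact: measurable_oitv.
  by congr EFin; rewrite normc_sqr.
have uv : u = v.1 +i* v.2.
  have /seteqP[/(_ _ vL2) + _] := weyl (xi +i* r) (lt0r_neq0 r0).
  by move=> /= ->.
rewrite uv /=.
apply: (weyl_bounds (B := wdot w a t C S)) => //.
have := keyK _ _ _ _ _ _ _ _ (combo_ivp cz sz v).
have := vdisc _ It.
rewrite -(ler_pM2l K0) => h1 /le_trans /(_ h1).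
by congr (_ <= _); ring.
Qed.
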